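(* Let $n\ge 2$, let $\delta\in(0,1)$, and let $M\subset\mathbb{S}^{n-1}$ be a closed subset satisfying $C_{\mathcal H}^{n-2+\delta}(M)>0$. Then there exist an absolute constant $C_1>0$ and a constant $C_2=C_2(M,n,\delta)>0$ such that, for every $N\in\mathbb{Z}^+$ and every spherical polynomial $p$ on $\mathbb{S}^{n-1}$ of degree at most $N$, $$\sup_{\mathbb{S}^{n-1}}|p|\le C_1\left(\left(\frac{C_2}{C_{\mathcal H}^{n-2+\delta}(M)}\right)^{\frac{2}{\delta}}N^{\frac{4}{\delta}-1}\right)^{2N}\sup_{M}|p|.$$
   Context: $\mathbb{S}^{n-1}$ is the unit sphere in $\mathbb{R}^n$. A spherical polynomial of degree at most $N$ is the restriction to $\mathbb{S}^{n-1}$ of a polynomial in $n$ variables of degree at most $N$. For $\alpha>0$ and $E\subset\mathbb{R}^n$, the $\alpha$-Hausdorff content is $C_{\mathcal H}^\alpha(E)=\inf\{\sum_{j=1}^\infty d(B_j)^\alpha: E\subset\bigcup_{j=1}^\infty B_j\}$, where the $B_j\subset\mathbb{R}^n$ are open balls and $d(B_j)$ is the diameter of $B_j$. *)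

(* Defs.v *)
From HB Require Import structures.
From mathcomp Require Import all_boot all_order all_algebra.
From mathcomp Require Import all_classical all_reals all_analysis.
From mathcomp Require mpoly.
(* The notations of mpoly clash with those of mathcomp-analysis. *)
Import -(notations) mpoly.

Set Implicit Arguments.
Unset Strict Implicit.
Unset Printing Implicit Defensive.

Import Order.TTheory GRing.Theory Num.Theory.
Import numFieldTopology.Exports numFieldNormedType.Exports.

Local Open Scope classical_set_scope.
Local Open Scope ring_scope.

Section SphericalPolynomials.
Context {R : realType} {n : nat}.
Implicit Types (x c : 'rV[R]_n) (A E M : set 'rV[R]_n).

(* The norm `|x| that the library puts on 'rV[R]_n is the sup norm; it induces
   the same topology, hence the same closed sets, but not the same sphere. *)
Definition enorm x : R := Num.sqrt (\sum_(i < n) x 0 i ^+ 2).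

Definition sphere : set 'rV[R]_n := [set x | enorm x = 1].

Definition eball c (r : R) : set 'rV[R]_n := [set x | enorm (x - c) < r].

Definition diam A : \bar R :=
  ereal_sup [set e | exists x y, [/\ A x, A y & e = (enorm (x - y))%:E]].

(* The balls are nonempty; finite covers are subsumed, since they can be
   completed with balls whose diameters have an arbitrarily small total
   contribution. *)
Definition hausdorff_content (alpha : R) E : \bar R :=
  ereal_inf [set s | exists (c : nat -> 'rV[R]_n) (r : nat -> R),
    [/\ (forall j, 0 < r j),
        E `<=` \bigcup_j eball (c j) (r j) &
        s = (\sum_(0 <= j <oo) (diam (eball (c j) (r j)) `^ alpha)%E)%E]].

(* Only the values of p on the sphere matter. The library's msize is the total
   degree plus one, and 0 for the zero polynomial. *)
Definition spherical_polynomial (N : nat) (p : 'rV[R]_n -> R) : Prop :=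
  exists P : mpoly.mpoly n R, (mpoly.msize P <= N.+1)%N /\
    forall x, sphere x -> p x = mpoly.meval (fun i => x 0 i) P.

Definition sup_abs A (p : 'rV[R]_n -> R) : R := sup [set `|p x| | x in A].

End SphericalPolynomials.

Arguments sphere {R} n.

(* Main.v *)
Require Import Defs.
From mathcomp Require Import all_boot all_order all_algebra.
From mathcomp Require Import all_classical all_reals all_analysis.
From mathcomp Require Import complex zify ring lra.
From mathcomp Require mpoly.
Import -(notations) mpoly.
Import Order.TTheory GRing.Theory Num.Theory.
Import numFieldTopology.Exports numFieldNormedType.Exports.

(* Fix a point y0 of the sphere. In affine coordinates on [0, 1)^d, d = n - 1,
   stereographic projection from y0 turns p into a polynomial q whose restriction
   to every coordinate line has degree exactly 2N and a leading coefficient of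
   modulus at least |p(y0)|.

   Call a segment in which a coordinate line crosses a dyadic cube of side 2^-j
   rough if |q| is not constant on it up to a factor 1 - 1/a_j. Then one of the
   2N complex roots of the restriction has its real part within 2N a_j cubes of
   the segment. Hence few segments are rough, and few cubes contain a positive
   proportion of rough segments: if a_j grows slowly and j0 is large enough,
   these cubes, for all scales j >= j0 together, have too little content to
   cover M. So some x in M lies in none of them. Moving one coordinate at a time
   along segments that are not rough, one sees that a lower bound for |q| on half
   of the cube of scale j around x persists, up to a factor (1 - 1/a_j)^d, on half
   of the cube of scale j + 1, and in the limit at x. At scale j0 such a bound is
   (c 2^-j0 / N)^(2N) |p(y0)|, by the factorization on lines.

   Lebesgue measure is replaced by counting on a fine dyadic grid, so that
   everything before the limit is finite. *)

Set Implicit Arguments.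
Unset Strict Implicit.
Unset Printing Implicit Defensive.

Local Open Scope ring_scope.

(** * Univariate polynomials near their roots *)

Section Univariate.
Variable R : rcfType.
Implicit Types (z : R[i]) (t u : R) (s : seq R[i]).

(** The modulus of t - z as an element of [R]; the norm on [R[i]] takes its values in [R[i]]. *)
Definition root_dist z t : R := Num.sqrt ((t - complex.Re z) ^+ 2 + complex.Im z ^+ 2).

Lemma root_distE z t : `|(t%:C)%C - z| = ((root_dist z t)%:C)%C.
Proof. by case: z => a b; rewrite normc_def /= sub0r sqrrN. Qed.

Lemma root_dist_ge z t : `|t - complex.Re z| <= root_dist z t.
Proof. by rewrite -sqrtr_sqr ler_wsqrtr// lerDl sqr_ge0. Qed.

Lemma root_dist_ge0 z t : 0 <= root_dist z t.
Proof. exact: sqrtr_ge0. Qed.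

Lemma root_dist_lip z t u : root_dist z t <= root_dist z u + `|t - u|.
Proof.
rewrite -(@lecR R) rmorphD/= -!root_distE.
have -> : (`|t - u|%:C)%C = `|(t%:C)%C - (u%:C)%C|.
  by rewrite -rmorphB normc_def/= expr0n addr0 sqrtr_sqr.
rewrite (_ : (t%:C)%C - z = ((u%:C)%C - z) + ((t%:C)%C - (u%:C)%C)) ?ler_normD//.
by ring.
Qed.

(** Split [F] into linear factors over the algebraically closed field [R[i]] and take moduli at a
    real point. *)
Lemma poly_abs_factor (F : {poly R}) : exists s, size s = (size F).-1 /\
  forall t, `|F.[t]| = `|lead_coef F| * \prod_(z <- s) root_dist z t.
Proof.
have [->|F0] := eqVneq F 0.
  exists [::]; rewrite size_poly0; split=> // t.
  by rewrite lead_coef0 horner0 normr0 mul0r.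
have [s sE] := closed_field_poly_normal (map_poly (real_complex R) F).
exists s; split.
  have := congr1 (size \o polyseq) sE; rewrite /= size_map_poly size_scale.
    by rewrite size_prod_XsubC => ->.
  by rewrite lead_coef_eq0 map_poly_eq0.
move=> t; have := congr1 (fun p => `|p.[(t%:C)%C]|) sE.
rewrite /= horner_map/= hornerZ normrM horner_prod normr_prod.
rewrite lead_coef_map.
have nC x : `|(x%:C)%C| = (`|x|%:C)%C by rewrite normc_def/= expr0n addr0 sqrtr_sqr.
rewrite !nC; under eq_bigr => z _ do rewrite hornerXsubC root_distE.
by rewrite -rmorph_prod -rmorphM => -[].
Qed.

Lemma bernoulli_le (x : R) k : 0 <= x <= 1 -> 1 - x *+ k <= (1 - x) ^+ k.
Proof.
move=> /andP[x0 x1]; elim: k => [|k IH]; first by rewrite mulr0n subr0 expr0.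
rewrite exprS mulrSr; have : (1 - x) ^+ k <= 1 by apply: exprn_ile1; lra.
have : 0 <= (1 - x) ^+ k by apply: exprn_ge0; lra. nra.
Qed.

Lemma prod_root_dist_ge s (e t : R) : 0 <= e ->
  (forall z, z \in s -> e <= root_dist z t) ->
  e ^+ size s <= \prod_(z <- s) root_dist z t.
Proof.
move=> e0; elim: s => [|z s IH] es; first by rewrite big_nil.
rewrite big_cons /= exprS; apply: ler_pM => //.
- exact: exprn_ge0.
- by rewrite es ?mem_head.
- by apply: IH => z' z's; rewrite es// inE z's orbT.
Qed.

(** A move by at most [e] leaves at least the fraction 1 - 1/A of a distance that is at least
    [e * A]; [bernoulli_le] bounds the product of these fractions. *)
Lemma prod_root_dist_near s (e A t u : R) :
  1 <= A -> 0 <= e -> `|t - u| <= e ->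
  (forall z, z \in s -> e * A <= `|t - complex.Re z|) ->
  (1 - (size s)%:R / A) * \prod_(z <- s) root_dist z t <= \prod_(z <- s) root_dist z u.
Proof.
move=> A1 e0 tu far.
have A0 : 0 < A by lra.
have Ai : 0 <= A^-1 <= 1 by rewrite invr_ge0 ltW//= invf_le1.
have h : (1 - A^-1) ^+ (size s) * \prod_(z <- s) root_dist z t <=
         \prod_(z <- s) root_dist z u.
  elim: s far => [|z s IH] far; first by rewrite !big_nil expr0 mulr1.
  rewrite !big_cons /= exprS mulrACA; apply: ler_pM.
  - by apply: mulr_ge0; [lra | exact: root_dist_ge0].
  - apply: mulr_ge0; first by apply: exprn_ge0; lra.
    by apply: prodr_ge0 => *; apply: root_dist_ge0.
  - have := root_dist_lip z t u; have := far z; rewrite inE eqxx => /(_ isT).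
    have := root_dist_ge z t => h1 h2 h3.
    have : e <= root_dist z t * A^-1 by rewrite ler_pdivlMr//; lra.
    lra.
  - by apply: IH => z' z's; apply: far; rewrite inE z's orbT.
apply: le_trans h; apply: ler_wpM2r.
  by rewrite prodr_ge0// => *; apply: root_dist_ge0.
by rewrite mulr_natl; apply: bernoulli_le.
Qed.

End Univariate.

(** * Rough cubes of a finite grid *)

Lemma card_block_near1 (T m : nat) (c : int) (A : nat) : (0 < m)%N ->
  (#|[set u : 'I_T | (`|Posz (u %/ m) - c|%N <= A)%N]| <= A.*2.+1 * m)%N.
Proof.
move=> m0; set S := [set _ | _].
(* All numbers with quotient within [A] of [c] and any remainder. The list need only contain the
   set, so the values of [absz] at negative quotients do no harm. *)
pose l := [seq (absz (c + Posz k - Posz A)%R * m + r)%N | k <- iota 0 A.*2.+1, r <- iota 0 m].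
have -> : (A.*2.+1 * m)%N = size l by rewrite size_allpairs !size_iota.
rewrite cardE -(size_map (@nat_of_ord T)).
apply: uniq_leq_size; first by rewrite map_inj_uniq ?enum_uniq//; exact: val_inj.
move=> x /mapP[u]; rewrite mem_enum inE => uA ->.
apply/allpairsP; exists (absz (Posz (u %/ m) - c + Posz A)%R, u %% m)%N.
split; [by rewrite mem_iota /=; lia | by rewrite mem_iota add0n ltn_pmod|].
by rewrite [LHS](divn_eq u m) /=; congr (_ * _ + _)%N; move: (u %/ m)%N uA => b; lia.
Qed.

Lemma card_block_near (T m : nat) (cs : seq int) (A : nat) : (0 < m)%N ->
  (#|[set u : 'I_T | has (fun c => (`|Posz (u %/ m) - c|%N <= A)%N) cs]|
    <= size cs * (A.*2.+1 * m))%N.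
Proof.
move=> m0; elim: cs => [|c cs IH] /=.
  by rewrite (_ : [set _ | _] = finset.set0) ?cards0//; apply/finset.setP => u; rewrite !inE.
rewrite mulSn; apply: leq_trans (leq_add (card_block_near1 T c A m0) IH).
apply: leq_trans (leq_card_setU _ _).
by apply/subset_leq_card/fintype.subsetP => u; rewrite !inE.
Qed.

Section Grid.
Variables (d T : nat).
Notation grid := {ffun 'I_d -> 'I_T}.
Implicit Types (g : grid) (i : 'I_d) (u : 'I_T) (B S : {set grid}).

Definition grid_set g i u : grid := [ffun k => if k == i then u else g k].

(** As [i] runs from 0 to [d], this leads from [g] to [g'] one coordinate at a time. *)
Definition mix (i : nat) g g' : grid := [ffun k : 'I_d => if (k < i)%N then g' k else g k].

Lemma mix0 g g' : mix 0 g g' = g.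
Proof. by apply/ffunP => k; rewrite ffunE. Qed.

Lemma mix_dim g g' : mix d g g' = g'.
Proof. by apply/ffunP => k; rewrite ffunE ltn_ord. Qed.

Lemma mixS i g g' : mix i.+1 g g' = grid_set (mix i g g') i (g' i).
Proof.
apply/ffunP => k; rewrite !ffunE ltnS leq_eqVlt val_eqE.
by case: eqVneq => [->|].
Qed.

Lemma grid_set_id g i : grid_set g i (g i) = g.
Proof. by apply/ffunP => k; rewrite ffunE; case: eqVneq => // ->. Qed.

Lemma grid_set_set g i u u' : grid_set (grid_set g i u) i u' = grid_set g i u'.
Proof. by apply/ffunP => k; rewrite !ffunE; case: eqVneq. Qed.

Lemma mix_swap i g g' : mix i (mix i g g') (mix i g' g) = g.
Proof. by apply/ffunP => k; rewrite !ffunE; case: ltnP. Qed.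

(** Exchanging the first [i] coordinates of [g] and [g'] is an involution on pairs, so each point is
    the mixture of at most |S| pairs from [S]. *)
Lemma card_mix (S B : {set grid}) i :
  (forall g g', g \in S -> g' \in S -> mix i g g' \in S) ->
  (#|[set p in finset.setX S S | mix i p.1 p.2 \in B]| <= #|S :&: B| * #|S|)%N.
Proof.
move=> Smix; rewrite -cardsX.
pose h (p : grid * grid) := (mix i p.1 p.2, mix i p.2 p.1).
have hinj : injective h.
  move=> [g1 g2] [g3 g4] [] /= e1 e2.
  have -> : g1 = g3 by rewrite -(mix_swap i g1 g2) e1 e2 mix_swap.
  by have -> : g2 = g4 by rewrite -(mix_swap i g2 g1) e1 e2 mix_swap.
rewrite -(card_imset _ hinj); apply/subset_leq_card/fintype.subsetP => _ /finset.imsetP[[g g'] + ->].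
rewrite !inE /= => /andP[/andP[gS g'S] mB].
by rewrite mB !Smix.
Qed.

(** Double counting on the lines in direction [i]: each point of [B] moves to |V| points of [S], and
    each point of [S] is reached from at most [c] points of [B], those on its line. *)
Lemma card_line (S B : {set grid}) (V : {set 'I_T}) i c :
  (forall b v, b \in B -> v \in V -> grid_set b i v \in S) ->
  (forall g, #|[set u | grid_set g i u \in B]| <= c)%N -> (#|V| * #|B| <= #|S| * c)%N.
Proof.
move=> BV Bc.
pose h (p : grid * 'I_T) := (grid_set p.1 i p.2, p.1 i).
have hinj : injective h.
  move=> [g u] [g' u'] [] /= e1 e2.
  have -> : u = u' by have /ffunP/(_ i) := e1; rewrite !ffunE eqxx.
  by congr pair; rewrite -(grid_set_id g i) e2 -(grid_set_set g i u) e1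
    grid_set_set grid_set_id.
rewrite mulnC -cardsX -(card_imset _ hinj).
have : h @: finset.setX B V \subset
    [set p : grid * 'I_T | (p.1 \in S) && (grid_set p.1 i p.2 \in B)].
  apply/fintype.subsetP => _ /finset.imsetP[[g u] + ->]; rewrite !inE /= => /andP[gB uV].
  by rewrite grid_set_set grid_set_id gB BV.
move/subset_leq_card/leq_trans; apply.
rewrite -sum1dep_card.
rewrite -(pair_big_dep (mem S) (fun g u => grid_set g i u \in B) (fun _ _ => 1%N)) /=.
rewrite -sum_nat_const.
by apply: leq_sum => g _; rewrite sum1dep_card.
Qed.

Lemma block_lt (u m : nat) : (u < T -> u %/ m < T)%N.
Proof. exact/leq_ltn_trans/leq_div. Qed.

(** The block indices are kept in ['I_T], so that cells of all scales have the type of grid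
    points. *)
Definition cell (m : nat) g : grid := [ffun k => Ordinal (block_lt m (ltn_ord (g k)))].

Definition cube (m : nat) g : {set grid} := [set g' | cell m g' == cell m g].

Lemma cubeP m g g' :
  reflect (forall k, (g' k %/ m = g k %/ m)%N) (g' \in cube m g).
Proof.
rewrite inE; apply: (iffP eqP) => [/ffunP e k|e].
  by have := congr1 val (e k); rewrite !ffunE.
by apply/ffunP => k; apply: val_inj; rewrite !ffunE /= e.
Qed.

Lemma cube_refl m g : g \in cube m g. Proof. exact/cubeP. Qed.

Lemma cube_mix m i x g g' :
  g \in cube m x -> g' \in cube m x -> mix i g g' \in cube m x.
Proof.
by move=> /cubeP h /cubeP h'; apply/cubeP => k; rewrite ffunE; case: ifP.
Qed.

Lemma card_block m (u : nat) : (u < T)%N -> (0 < m)%N -> (m %| T)%N ->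
  #|[pred v : 'I_T | v %/ m == u %/ m]%N| = m.
Proof.
move=> uT m0 mT; set b := (u %/ m)%N.
have lim (r : 'I_m) : (b * m + r < T)%N.
  have /divnK Tm := mT.
  have : (b < T %/ m)%N by rewrite ltn_divRL// (leq_ltn_trans (leq_trunc_div _ _)).
  by have := ltn_ord r; nia.
pose h (r : 'I_m) : 'I_T := Ordinal (lim r).
have hinj : injective h by move=> r r' [] /addnI /val_inj.
rewrite -[RHS]card_ord -(fintype.card_image hinj) /=.
apply: eq_card => v; rewrite inE; apply/eqP/fintype.imageP => [vb|[r _ ->]] /=.
  exists (Ordinal (ltn_pmod v m0)) => //.
  by apply: val_inj; rewrite /= -vb -divn_eq.
by rewrite divnMDl// divn_small ?addn0.
Qed.

Lemma card_cube m g : (0 < m)%N -> (m %| T)%N -> #|cube m g| = (m ^ d)%N.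
Proof.
move=> m0 mT.
have -> : #|cube m g| = #|family (fun k => [pred v : 'I_T | v %/ m == g k %/ m]%N)|.
  apply: eq_card => g'; apply/cubeP/familyP => h k; first by rewrite inE h.
  by have := h k; rewrite inE => /eqP.
rewrite card_family /image_mem -[in RHS](card_ord d) cardE.
by elim: (enum _) => //= k e ->; rewrite card_block// expnS.
Qed.

Lemma cube_half m g : cube m g \subset cube (m * 2) g.
Proof.
by apply/fintype.subsetP => g' /cubeP h; apply/cubeP => k; rewrite !divnMA h.
Qed.

End Grid.

(** * Rough segments and one step of the propagation *)

Section Roughness.
Variables (R : realDomainType) (d T : nat).
Notation grid := {ffun 'I_d -> 'I_T}.
Variable f : grid -> R.
Implicit Types (g x : grid) (i : 'I_d).

Definition flat (m : nat) (tau : R) i g :=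
  [forall u : 'I_T, forall u' : 'I_T, ((u %/ m == g i %/ m) && (u' %/ m == g i %/ m))%N ==>
     ((1 - tau) * f (grid_set g i u) <= f (grid_set g i u'))].

Definition rough m tau i : {set grid} := [set g | ~~ flat m tau i g].

(** The threshold 2^-(d+2) suits [typical_step]: 2^-d for the passage to a cube of half the side,
    and 1/2 for each of the two halves in its statement. *)
Definition is_rough_cube m tau g :=
  (#|cube m g| <= 2 ^ d.+2 * \sum_i #|cube m g :&: rough m tau i|)%N.

Definition rough_cells m tau : {set grid} := cell m @: [set g | is_rough_cube m tau g].

(** Markov's inequality: distinct cubes are disjoint, and each rough one contributes at least m^d /
    2^(d+2) to the sum. *)
Lemma card_rough_cells m tau : (0 < m)%N -> (m %| T)%N ->
  (#|rough_cells m tau| * m ^ d <= 2 ^ d.+2 * \sum_i #|rough m tau i|)%N.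
Proof.
move=> m0 mT; rewrite -sum_nat_const.
pose cnt i (a : grid) := #|[set g in rough m tau i | cell m g == a]|.
have cntE i : (\sum_(a : grid) cnt i a = #|rough m tau i|)%N.
  rewrite -sum1_card [RHS](partition_big (cell m) xpredT)//=.
  by apply: eq_bigr => a _; rewrite /cnt -sum1dep_card.
apply: (@leq_trans (\sum_(a in rough_cells m tau) 2 ^ d.+2 * \sum_i cnt i a)%N).
  apply: leq_sum => _ /finset.imsetP[g + ->]; rewrite inE /is_rough_cube card_cube//.
  move=> /leq_trans; apply; rewrite leq_mul2l leq_sum ?orbT// => i _.
  by apply/subset_leq_card/fintype.subsetP => g'; rewrite !inE andbC.
rewrite -big_distrr /= leq_mul2l exchange_big leq_sum ?orbT// => i _.
by rewrite -cntE [leqRHS](bigID (mem (rough_cells m tau))) /= leq_addr.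
Qed.

(** If the path [mix] from a good point [g] of the large cube to a point [g'] of the small one meets
    no rough segment, then f g' >= (1 - tau)^d v. Were the conclusion false, every good [g] would
    have bad paths to more than half of the small cube; by [card_mix], a cube that is not rough has
    too few bad pairs for that. *)
Lemma typical_step m tau x (v : R) : (0 < m)%N -> (m * 2 %| T)%N -> tau <= 1 ->
  ~~ is_rough_cube (m * 2) tau x ->
  (#|cube (m * 2) x| <= 2 * #|[set g in cube (m * 2) x | (v <= f g)%R]|)%N ->
  (#|cube m x| <= 2 * #|[set g in cube m x | ((1 - tau) ^+ d * v <= f g)%R]|)%N.
Proof.
move=> m0 mT tau1; rewrite /is_rough_cube -ltnNge.
set S := cube (m * 2) x; set S' := cube m x; set A := [set g in S | _] => nr hA.
set A' := [set g in S' | _]; rewrite leqNgt; apply/negP => hA'.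
pose bp := [set p in finset.setX S S | [exists i : 'I_d, mix i p.1 p.2 \in rough (m * 2) tau i]].
have cS : #|S| = (2 ^ d * #|S'|)%N.
  by rewrite /S /S' !card_cube ?muln_gt0 ?m0// ?(dvdn_trans _ mT) ?dvdn_mulr// expnMn mulnC.
have cbp : (#|bp| <= (\sum_i #|S :&: rough (m * 2) tau i|) * #|S|)%N.
  rewrite big_distrl /=.
  pose bi i := [set p in finset.setX S S | mix i p.1 p.2 \in rough (m * 2) tau i].
  apply: (@leq_trans (\sum_i #|bi i|)%N); last first.
    by apply: leq_sum => i _; apply: card_mix => g g'; exact: cube_mix.
  have -> : bp = (\bigcup_i bi i)%SET.
    apply/finset.setP => p; apply/setIdP/finset.bigcupP => [[pS /existsP[i pi]]|[i _]].
      by exists i => //; apply/setIdP.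
    by move=> /setIdP[pS pi]; split=> //; apply/existsP; exists i.
  elim/big_ind2: _ => // [|B1 n1 B2 n2 h1 h2]; first by rewrite cards0.
  exact: leq_trans (leq_card_setU _ _) (leq_add h1 h2).
have good g g' : g \in A -> g' \in S' -> (g, g') \notin bp -> g' \in A'.
  rewrite !inE => /andP[gS vg] g'S' nb; rewrite g'S' /=.
  have g'S : g' \in S by apply: (fintype.subsetP (cube_half m x)); rewrite inE.
  have {}gS : g \in S by rewrite inE.
  have fl i : flat (m * 2) tau i (mix i g g').
    apply: contraNT nb => h; rewrite !inE in gS g'S *; rewrite gS g'S /=.
    by apply/existsP; exists i; rewrite inE.
  have ind k : (k <= d)%N -> (1 - tau) ^+ k * v <= f (mix k g g').
    elim: k => [|k IH] kd; first by rewrite expr0 mul1r mix0.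
    rewrite exprS -mulrA -[k]/(val (Ordinal kd)) mixS; set i := Ordinal kd.
    have /forallP/(_ (mix i g g' i))/forallP/(_ (g' i)) := fl i.
    have /cubeP/(_ i) -> := cube_mix i gS g'S; have /cubeP/(_ i) -> := g'S.
    rewrite eqxx /= grid_set_id; apply: le_trans.
    by apply: ler_wpM2l; [rewrite subr_ge0 | apply: IH; apply: ltnW].
  by rewrite -(mix_dim g g') ind.
have low : (#|A| * #|S'| <= 2 * #|bp|)%N.
  have -> : (#|A| * #|S'|)%N = (\sum_(g in A) #|S'|)%N by rewrite sum_nat_const.
  apply: (@leq_trans (2 * \sum_(g in A) #|[set g' in S' | (g, g') \in bp]|)%N).
    rewrite big_distrr; apply: leq_sum => g gA /=.
    have : (#|S'| <= #|A'| + #|[set g' in S' | (g, g') \in bp]|)%N.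
      apply: leq_trans (leq_card_setU _ _); apply/subset_leq_card/fintype.subsetP => g' g'S.
      rewrite inE; case: (boolP ((g, g') \in bp)) => h; last by rewrite (good g).
      by rewrite [X in _ || X]inE g'S h orbT.
    move: hA'; move: #|A'| #|S'| #|[set g' in S' | _]| => a b c; clear; lia.
  rewrite leq_mul2l /=.
  have -> : (\sum_(g in A) #|[set g' in S' | (g, g') \in bp]| =
     #|[set p in finset.setX A S' | p \in bp]|)%N.
    rewrite -sum1dep_card (eq_bigl (fun p => (p.1 \in A) && ((p.2 \in S') && ((p.1,p.2) \in bp)))).
      rewrite -(pair_big_dep (mem A) (fun g g' => (g' \in S') && ((g, g') \in bp)) (fun _ _ => 1%N)) /=.
      by apply: eq_bigr => g _; rewrite sum1dep_card.
    by move=> [g g'] /=; rewrite finset.in_setX andbA.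
  by apply/subset_leq_card/fintype.subsetP => p /setIdP[].
have S0 : (0 < #|S|)%N by apply/card_gt0P; exists x; exact: cube_refl.
have h1 : (#|S| * #|S'| <= 4 * #|bp|)%N.
  by move: hA low; move: #|A| #|S'| #|bp| #|S| => a b c e; clear; nia.
have h2 : (#|S| * #|S| <= 2 ^ d.+2 * #|bp|)%N.
  rewrite {2}cS !expnS; move: h1; move: #|S'| #|bp| #|S| (2 ^ d)%N => a b c e.
  by clear; nia.
move: (leq_trans h2 (leq_mul (leqnn _) cbp)); rewrite mulnA leq_mul2r => /orP[/eqP h|].
  by move: S0; rewrite h.
by rewrite leqNgt nr.
Qed.

End Roughness.

(** * Propagation through dyadic scales *)

Definition update (R : Type) d (y : 'I_d -> R) i t : 'I_d -> R :=
  fun k => if k == i then t else y k.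

Definition grid_pt (R : realType) d T (g : {ffun 'I_d -> 'I_T}) : 'I_d -> R :=
  fun k => (g k)%:R / T%:R.

Lemma grid_pt_set (R : realType) d T (g : {ffun 'I_d -> 'I_T}) i u :
  grid_pt R (grid_set g i u) = update (grid_pt R g) i (u%:R / T%:R).
Proof. by apply: funext => k; rewrite /grid_pt /update ffunE; case: eqVneq. Qed.

Lemma block_bounds (R : realType) (u m n : nat) : (0 < m)%N -> (0 < n)%N ->
  (u %/ m)%:R <= n%:R * (u%:R / (n * m)%:R : R) < (u %/ m)%:R + 1.
Proof.
move=> m0 n0.
have m0' : 0 < m%:R :> R by rewrite ltr0n.
have -> : n%:R * (u%:R / (n * m)%:R) = u%:R / m%:R :> R.
  by rewrite natrM; field; rewrite !pnatr_eq0 -!lt0n m0 n0.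
rewrite ler_pdivlMr// ltr_pdivrMr// natr1 -!natrM ler_nat ltr_nat.
by rewrite leq_trunc_div ltn_ceil.
Qed.

(** The strict inequality between integers absorbs the two fractional parts. *)
Lemma far_floor (R : realType) (b A : nat) (w t : R) :
  (A < `|Posz b - Num.floor w|%N)%N -> b%:R <= t < b%:R + 1 -> A%:R <= `|t - w|.
Proof.
move=> far /andP[t0 t1].
have A0 : 0 <= A%:R :> R by [].
have /andP[w0 w1] := floor_itv w.
have [bw|bw] := leP (Num.floor w) (Posz b).
  have : (Num.floor w + A%:Z + 1 <= b%:Z)%R by lia.
  rewrite -(ler_int R) !intrD /=.
  rewrite intrD /= in w1.
  rewrite (_ : (Posz A)%:~R = A%:R)// (_ : (Posz b)%:~R = b%:R)// => h.
  rewrite ger0_norm; lra.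
have : (b%:Z + A%:Z + 1 <= Num.floor w)%R by lia.
rewrite -(ler_int R) !intrD /=.
rewrite (_ : (Posz A)%:~R = A%:R)// (_ : (Posz b)%:~R = b%:R)// => h.
rewrite ler0_norm; lra.
Qed.

(** * Functions that are polynomials of degree [D] on coordinate lines *)

Section Core.
Variables (R : realType) (d D : nat) (q : ('I_d -> R) -> R) (c : R).
Hypothesis D_gt0 : (0 < D)%N.
Hypothesis c_ge0 : 0 <= c.
Hypothesis q_line : forall y i, exists F : {poly R},
  [/\ size F = D.+1, c <= `|lead_coef F| & forall t, q (update y i t) = F.[t]].

Definition grid_abs T (g : {ffun 'I_d -> 'I_T}) : R := `|q (grid_pt R g)|.

Lemma grid_abs_line T (g : {ffun 'I_d -> 'I_T}) i : exists s : seq R[i],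
  exists2 l, c <= l & size s = D /\
  forall u, grid_abs (grid_set g i u) = l * \prod_(z <- s) root_dist z (u%:R / T%:R).
Proof.
have [F [sF cF qF]] := q_line (grid_pt R g) i.
have [s [ss Fs]] := poly_abs_factor F.
exists s, `|lead_coef F| => //; split; first by rewrite ss sF.
by move=> u; rewrite /grid_abs grid_pt_set qF Fs.
Qed.

(** There are [n] blocks of [m] points on a line. If the block of [u] is more than D a blocks away
    from the real part of every root, [prod_root_dist_near] applies with [e] = 1/n and [A] = D a,
    and the loss is D / (D a) = 1/a. *)
Lemma card_rough_line (T m n a : nat) (g : {ffun 'I_d -> 'I_T}) i :
  T = (n * m)%N -> (0 < m)%N -> (0 < n)%N -> (0 < a)%N ->
  (#|[set u | grid_set g i u \in rough (@grid_abs T) m a%:R^-1 i]|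
    <= D * ((D * a).*2.+1 * m))%N.
Proof.
move=> TE m0 n0 a0.
have [s [l cl [ss fE]]] := grid_abs_line g i.
have l0 : 0 <= l by apply: le_trans cl.
pose cs := [seq Num.floor (n%:R * complex.Re z) | z <- s].
have <- : size cs = D by rewrite size_map.
have n0' : 0 < n%:R :> R by rewrite ltr0n.
apply: leq_trans (card_block_near T cs (size cs * a) m0).
apply/subset_leq_card/fintype.subsetP => u; rewrite !inE; apply: contraNT => far.
apply/forallP => u1; apply/forallP => u2; apply/implyP => /andP[].
rewrite !ffunE eqxx => /eqP e1 /eqP e2; rewrite !grid_set_set !fE.
rewrite mulrCA; apply: ler_wpM2l => //.
have DaE : ((D * a)%:R : R) = D%:R * a%:R by rewrite natrM.
have a1 : 1 <= a%:R :> R by rewrite ler1n.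
have D1 : 1 <= D%:R :> R by rewrite ler1n.
have /andP[b1 b1'] := block_bounds R u1 m0 n0.
have /andP[b2 b2'] := block_bounds R u2 m0 n0.
rewrite -TE e1 in b1 b1'; rewrite -TE e2 in b2 b2'.
have -> : a%:R^-1 = (size s)%:R / (D * a)%:R :> R.
  by rewrite ss DaE; field; rewrite !pnatr_eq0 -!lt0n a0 D_gt0.
apply: (@prod_root_dist_near _ _ n%:R^-1).
- by rewrite DaE; nra.
- by rewrite invr_ge0 ltW.
- rewrite -(ler_pM2l n0') mulfV ?gt_eqF// -{1}(gtr0_norm n0') -normrM mulrBr.
  by rewrite ler_norml; lra.
move=> z zs; rewrite -(ler_pM2l n0') mulVKf ?gt_eqF//.
rewrite -{1}(gtr0_norm n0') -normrM mulrBr.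
apply: (@far_floor _ (u %/ m)); last by rewrite b1 b1'.
rewrite ltnNge; apply: contra far => h; apply/hasP.
exists (Num.floor (n%:R * complex.Re z)); first by apply/mapP; exists z.
by rewrite size_map ss.
Qed.

(** [card_line] turns the count on lines into a count of rough points, and [card_rough_cells] turns
    this into a count of cells. The powers of [m] cancel, so the bound does not depend on the
    fineness of the grid. *)
Lemma card_rough_cells_le (T m n a : nat) :
  T = (n * m)%N -> (0 < m)%N -> (0 < n)%N -> (0 < a)%N -> (0 < d)%N ->
  (#|rough_cells (@grid_abs T) m a%:R^-1|
    <= 2 ^ d.+2 * d * (D * (D * a).*2.+1) * n ^ d.-1)%N.
Proof.
move=> TE m0 n0 a0 d0; set RC := #|_|; set X := (D * (D * a).*2.+1)%N.
have h i : (T * #|rough (@grid_abs T) m a%:R^-1 i| <= T ^ d * (X * m))%N.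
  rewrite /X -mulnA.
  have := @card_line d T [set: _]%SET (rough (@grid_abs T) m a%:R^-1 i) [set: _]%SET i _ _
    (fun g => card_rough_line g i TE m0 n0 a0).
  by rewrite !cardsT card_ffun !card_ord; apply=> *; rewrite inE.
have h2 := @card_rough_cells R d T (@grid_abs T) m a%:R^-1 m0 _.
have {}h2 := h2 ltac:(by rewrite TE dvdn_mull).
have h3 : (T * (RC * m ^ d) <= 2 ^ d.+2 * (d * (T ^ d * (X * m))))%N.
  apply: leq_trans (leq_mul (leqnn T) h2) _; rewrite mulnCA leq_mul2l.
  have -> : (d * (T ^ d * (X * m)) = \sum_(i < d) (T ^ d * (X * m)))%N.
    by rewrite sum_nat_const card_ord.
  by apply/orP; right; rewrite big_distrr /=; apply: leq_sum.
have md0 : (0 < m ^ d)%N by rewrite expn_gt0 m0.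
have pos : (0 < n * m * m ^ d)%N by rewrite !muln_gt0 n0 m0.
rewrite -(leq_pmul2l pos).
apply: leq_trans (_ : T * (RC * m ^ d) <= _)%N; first by rewrite TE; nia.
apply: leq_trans h3 _.
have nd : (n ^ d = n * n ^ d.-1)%N by rewrite -expnS prednK.
by rewrite TE expnMn nd leq_eqVlt; apply/orP; left; apply/eqP; ring.
Qed.

(* On a line the values that are too small lie near the real parts of the [D]
   roots, so they occupy at most half of a cube. *)
Lemma typical_base (T m n : nat) (x : {ffun 'I_d -> 'I_T}) :
  T = (n * m)%N -> (0 < n)%N -> (8 * D <= m)%N -> (0 < d)%N ->
  (#|cube m x| <= 2 * #|[set g in cube m x | (c * ((16 * D * n)%:R^-1) ^+ D <= grid_abs g)%R]|)%N.
Proof.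
move=> TE n0 Dm d0; set v := c * _.
have m0 : (0 < m)%N by apply: leq_trans Dm; rewrite muln_gt0.
set S := cube m x; pose B := [set g in S | (grid_abs g < v)%R]%SET.
have SE : #|S| = (#|[set g in S | (v <= grid_abs g)%R]%SET| + #|B|)%N.
  rewrite -cardsUI (_ : _ :&: B = finset.set0)%SET ?cards0 ?addn0.
    by apply: eq_card => g; rewrite !inE; case: (leP v) => /=; rewrite ?andbT ?andbF ?orbF.
  by apply/finset.setP => g; rewrite !inE; case: (leP v) => /=; rewrite ?andbF.
(* Small enough that the at most D (2A + 1) points of a line near a root fill at most half of a
   block, and large enough that A / T >= 1 / (16 D n). *)
pose A := (m %/ (8 * D))%N.
have AD : (A * (8 * D) <= m)%N := leq_trunc_div _ _.
have AD' : (m < A.+1 * (8 * D))%N by rewrite ltn_ceil// muln_gt0.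
have A0 : (0 < A)%N by rewrite divn_gt0// muln_gt0.
pose i := Ordinal d0.
have T0 : (0 < T)%N by rewrite TE muln_gt0 n0.
have T0' : 0 < T%:R :> R by rewrite ltr0n.
have line g : (#|[set u | grid_set g i u \in B]%SET| <= D * (A.*2.+1 * 1))%N.
  have [s [l cl [ss fE]]] := grid_abs_line g i.
  pose cs := [seq Num.floor (T%:R * complex.Re z) | z <- s].
  have csD : size cs = D by rewrite size_map.
  rewrite -[X in (_ <= X * _)%N]csD; apply: leq_trans (card_block_near T cs A (leqnn 1)).
  apply/subset_leq_card/fintype.subsetP => u; rewrite inE => /setIdP[_].
  rewrite fE inE; apply: contraTT => far; rewrite -leNgt /v.
  apply: ler_pM; [exact: c_ge0 | by apply: exprn_ge0; rewrite invr_ge0 | exact: cl |].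
  rewrite -[X in _ ^+ X]ss; apply: prod_root_dist_ge => [|z zs]; first by rewrite invr_ge0.
  apply: le_trans (root_dist_ge z _).
  have : A%:R <= `|u%:R - T%:R * complex.Re z|.
    apply: (@far_floor _ (u %/ 1)); last by rewrite divn1 lexx ltrDl ltr01.
    rewrite ltnNge; apply: contra far => h; apply/hasP.
    by exists (Num.floor (T%:R * complex.Re z)) => //; apply/mapP; exists z.
  have -> : u%:R - T%:R * complex.Re z = T%:R * (u%:R / T%:R - complex.Re z).
    by field; rewrite gt_eqF.
  rewrite normrM gtr0_norm// -ler_pdivrMl// ; apply: le_trans.
  rewrite ler_pdivlMl// ler_pdivrMr ?ltr0n ?muln_gt0 ?D_gt0 ?n0//.
  rewrite -natrM ler_nat TE; apply: (@leq_trans (n * (A * (16 * D)))%N).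
    rewrite leq_mul2l; apply/orP; right.
    by apply: leq_trans (ltnW AD') _; move: A0; generalize A => a; clear; nia.
  by rewrite leq_eqVlt; apply/orP; left; apply/eqP; ring.
have /leq_trans h : (m * #|B| <= #|S| * (D * (A.*2.+1 * 1)))%N.
  pose V := [set u : 'I_T | (u %/ m == x i %/ m)%N]%SET.
  have <- : #|V| = m.
    by rewrite cardsE; apply: card_block => //; rewrite TE dvdn_mull.
  apply: (@card_line _ _ S B V i _ _ line) => b u /setIdP[/cubeP bS _].
  rewrite inE => /eqP uV; apply/cubeP => k; rewrite ffunE.
  by case: eqVneq => [->|].
have {}h : (2 * (m * #|B|) <= m * #|S|)%N.
  rewrite mulnC -mulnA.
  move: (h _ (leqnn _)); move: AD A0 => hA hA0.
  have : (2 * (D * (A.*2.+1 * 1)) <= m)%N.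
    by move: hA hA0; generalize A => a; clear; nia.
  move: #|S| #|B| (D * _)%N => p r e; clear; nia.
by rewrite mulnCA leq_pmul2l// in h; move: h; rewrite SE; move: #|_| #|_| => p r; lia.
Qed.

(** * Descent from scale [j0] to a point *)

Section Chain.
Variables (a : nat -> nat) (j0 : nat).
Hypothesis d_gt0 : (0 < d)%N.
Hypothesis a_gt0 : forall j, (0 < a j)%N.
Hypothesis sum_a : forall n, \sum_(0 <= j < n) (d%:R / (a j)%:R) <= 2^-1 :> R.

(** The product of numbers in [0, 1] is at least 1 minus the sum of their defects; the bounds by 0
    and 1 in [h] carry the induction. *)
Lemma prod_loss_ge (n : nat) : 2^-1 <= \prod_(j0 <= j < n) (1 - (a j)%:R^-1 : R) ^+ d.
Proof.
have itv j : 0 <= (1 - (a j)%:R^-1 : R) ^+ d <= 1.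
  have : 0 <= ((a j)%:R^-1 : R) <= 1 by rewrite invr_ge0 ler0n invf_le1 ?ltr0n ?ler1n ?a_gt0.
  by move=> /andP[? ?]; apply/andP; split; [apply: exprn_ge0 | apply: exprn_ile1]; lra.
have step j : 1 - d%:R / (a j)%:R <= (1 - (a j)%:R^-1 : R) ^+ d.
  rewrite mulr_natl; apply: bernoulli_le.
  by rewrite invr_ge0 ler0n invf_le1 ?ltr0n ?ler1n ?a_gt0.
have [nj|jn] := leqP n j0; first by rewrite big_geq// invf_le1 ?ler1n ?ltr0n.
have h k : 1 - \sum_(j0 <= j < k) (d%:R / (a j)%:R) <=
    \prod_(j0 <= j < k) (1 - (a j)%:R^-1 : R) ^+ d <= 1 /\
    0 <= \prod_(j0 <= j < k) (1 - (a j)%:R^-1 : R) ^+ d.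
  have [kj|] := leqP k j0; first by rewrite !big_geq// subr0 lexx ler01.
  elim: k => // k IH; rewrite ltnS leq_eqVlt => /orP[/eqP <-|jk].
    rewrite !big_nat1; have /andP[-> ->] := itv j0; split=> //.
    by rewrite step.
  have [/andP[h1 h2] h3] := IH jk; rewrite !big_nat_recr ?(ltnW jk)//.
  have /andP[i1 i2] := itv k; have := step k => /=.
  set P := \prod_(_ <= _ < _) _ in h1 h2 h3 *; set S := \sum_(_ <= _ < _) _ in h1 *.
  by set b := _ ^+ d in i1 i2 * => h4; split; [apply/andP; split|]; nra.
have [/andP[+ _] _] := h n; apply: le_trans.
have := sum_a n; rewrite (big_cat_nat (n := j0))//=; last exact: ltnW.
have : 0 <= \sum_(0 <= j < j0) (d%:R / (a j)%:R) :> R.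
  by apply: sumr_ge0 => j _; rewrite divr_ge0.
by lra.
Qed.

(** A cube of scale [j] has 2^(K - j) grid points along an edge. [typical_base] starts at scale
    [j0], and [typical_step] leads from each scale to the next. *)
Lemma typical_chain K (x : {ffun 'I_d -> 'I_(2 ^ K)}) :
  (j0 <= K)%N -> (8 * D <= 2 ^ (K - j0))%N ->
  (forall j, (j0 <= j < K)%N ->
     ~~ is_rough_cube (@grid_abs _) (2 ^ (K - j)) (a j)%:R^-1 x) ->
  c * ((16 * D * 2 ^ j0)%:R^-1) ^+ D <= 2 * grid_abs x.
Proof.
move=> jK DK smooth; set v := c * _.
have v0 : 0 <= v by rewrite mulr_ge0// exprn_ge0// invr_ge0.
have ind n : (j0 + n <= K)%N ->
    (#|cube (2 ^ (K - (j0 + n))) x| <= 2 * #|[set g in cube (2 ^ (K - (j0 + n))) x |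
       ((\prod_(j0 <= l < j0 + n) (1 - (a l)%:R^-1) ^+ d) * v <= grid_abs g)%R]|)%N.
  elim: n => [|n IH].
    rewrite addn0 big_geq// mul1r => _.
    by apply: typical_base; rewrite ?expn_gt0// -expnD subnKC.
  rewrite addnS => jK'; rewrite big_nat_recr ?leq_addr//= [X in X * v]mulrC -mulrA.
  have KE : (2 ^ (K - (j0 + n)) = 2 ^ (K - (j0 + n).+1) * 2)%N by rewrite -expnSr subnSK.
  apply: typical_step; rewrite -?KE ?expn_gt0//.
  - by apply: dvdn_exp2l; exact: leq_subr.
  - by rewrite invf_le1 ?ltr0n ?ler1n ?a_gt0.
  - by apply: smooth; rewrite leq_addr.
  - by apply: IH; exact: ltnW.
have := ind (K - j0)%N; rewrite subnKC// => /(_ (leqnn K)); rewrite subnn expn0 card_cube// exp1n.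
set G := finset _ => hG.
(* At scale [K] the cube is the single point [x], so at least half of it is all of it. *)
have /card_gt0P[g] : (0 < #|G|)%N by move: #|G| hG; lia.
rewrite inE => /andP[/cubeP gx].
have -> : g = x by apply/ffunP => k; apply: val_inj; have := gx k; rewrite !divn1.
have := prod_loss_ge K; set P := \prod_(_ <= _ < _) _ => h1 h2.
by nra.
Qed.

(** The last hypothesis says that families of cells no larger than the rough ones cannot catch all
    of [M]. So for each [K] some [y] in [M] avoids the rough cells. [typical_chain] at the grid
    point next to [y], with the Lipschitz bound, gives the claim up to an error of order 2^-K, and
    [K] is arbitrary. *)
Lemma lead_coef_le (M : ('I_d -> R) -> Prop) (bnd lip : R) :
  (forall y, M y -> `|q y| <= bnd /\ forall k, 0 <= y k < 1) ->
  (forall (e : R) (y y' : 'I_d -> R), 0 <= e -> (forall k, 0 <= y k <= 1) -> (forall k, 0 <= y' k <= 1) ->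
     (forall k, `|y k - y' k| <= e) -> `|q y - q y'| <= lip * e) ->
  (forall K (B : nat -> {set {ffun 'I_d -> 'I_(2 ^ K)}}),
     (forall j, (j0 <= j < K)%N -> #|B j| <=
        2 ^ d.+2 * d * (D * (D * a j).*2.+1) * (2 ^ j) ^ d.-1)%N ->
     exists y, M y /\ forall j, (j0 <= j < K)%N -> forall b, b \in B j ->
       ~ (forall k, (b k)%:R <= 2 ^+ j * y k < (b k)%:R + 1)) ->
  c * ((16 * D * 2 ^ j0)%:R^-1) ^+ D <= 2 * bnd.
Proof.
move=> My qlip cov; set v := c * _.
have main K : (j0 <= K)%N -> (8 * D <= 2 ^ (K - j0))%N ->
    v <= 2 * (bnd + lip * (2 ^+ K)^-1).
  move=> jK DK.
  pose B j := rough_cells (@grid_abs (2 ^ K)) (2 ^ (K - j)) (a j)%:R^-1.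
  have [j /andP[_ jK']|y [yM yB]] := cov K B.
    by apply: card_rough_cells_le; rewrite ?expn_gt0// -expnD subnKC// ltnW.
  have [yb y01] := My y yM.
  have K0 : 0 < 2 ^+ K :> R by rewrite exprn_gt0.
  have tr k : (Num.truncn (2 ^+ K * y k) < 2 ^ K)%N.
    have /andP[y0 y1] := y01 k.
    have y2 : 0 <= 2 ^+ K * y k by apply: mulr_ge0 => //; exact: ltW.
    by rewrite truncn_lt_nat// natrX -[ltRHS]mulr1 ltr_pM2l.
  pose x : {ffun 'I_d -> 'I_(2 ^ K)} := [ffun k => Ordinal (tr k)].
  have xb k : (x k)%:R <= 2 ^+ K * y k < (x k)%:R + 1.
    rewrite ffunE /= natr1; apply: truncn_itv.
    by have /andP[? _] := y01 k; rewrite mulr_ge0// ltW.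
  have smooth j : (j0 <= j < K)%N ->
     ~~ is_rough_cube (@grid_abs _) (2 ^ (K - j)) (a j)%:R^-1 x.
    move=> jj; apply/negP => rx; apply: (yB j jj (cell (2 ^ (K - j)) x)).
      by apply/imsetP; exists x; rewrite ?inE.
    move=> k; rewrite ffunE /=.
    have /andP[_ jK'] := jj; set m := (2 ^ (K - j))%N.
    have m0 : (0 < m)%N by rewrite expn_gt0.
    have m0' : 0 < m%:R :> R by rewrite ltr0n.
    have KE : 2 ^+ K = 2 ^+ j * m%:R :> R by rewrite natrX -exprD subnKC// ltnW.
    have /andP[h1 h2] := xb k; rewrite KE in h1 h2.
    rewrite -(ler_pM2r m0') -(ltr_pM2r m0') natr1 -!natrM mulrAC; apply/andP; split.
      by apply: le_trans h1; rewrite ler_nat leq_trunc_div.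
    apply: lt_le_trans h2 _; rewrite natr1 ler_nat.
    by rewrite ltn_ceil.
  have h := typical_chain jK DK smooth.
  have : `|q (grid_pt R x) - q y| <= lip * (2 ^+ K)^-1.
    have xy k : `|grid_pt R x k - y k| <= (2 ^+ K)^-1 /\ 0 <= grid_pt R x k <= 1.
      rewrite /grid_pt natrX; have /andP[h1 h2] := xb k; split.
        rewrite -(ler_pM2l K0) mulfV ?gt_eqF// -{1}(gtr0_norm K0) -normrM mulrBr.
        by rewrite mulrCA mulfV ?gt_eqF// mulr1 ler_norml; lra.
      rewrite divr_ge0 ?(ltW K0)//= ler_pdivrMr// mul1r -natrX ler_nat.
      exact/ltnW/ltn_ord.
    apply: qlip => [|k|k|k]; first by rewrite invr_ge0 ltW.
    + by case: (xy k).
    + by have /andP[-> /ltW ->] := y01 k.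
    + by case: (xy k).
  have := ler_normD (q (grid_pt R x) - q y) (q y); rewrite subrK.
  by move: h; rewrite /grid_abs -/v; lra.
rewrite leNgt; apply/negP => lt.
have gap : 0 < v - 2 * bnd by lra.
pose K1 := Num.bound `|2 * lip / (v - 2 * bnd)|.
(* [K1] makes the Lipschitz error smaller than the gap; the other summand ensures the hypotheses of
   [main]. *)
pose K := (K1 + (j0 + 8 * D))%N.
have big n : (n < 2 ^ n)%N by exact: ltn_expl.
have hK : v <= 2 * (bnd + lip * (2 ^+ K)^-1).
  apply: main; first by rewrite /K; lia.
  apply: leq_trans (ltnW (big (8 * D)%N)) _.
  by rewrite leq_exp2l// /K; lia.
have K0 : 0 < 2 ^+ K :> R by rewrite exprn_gt0.
have : 2 * lip / (v - 2 * bnd) < 2 ^+ K.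
  apply: (@le_lt_trans _ _ `|2 * lip / (v - 2 * bnd)|); first exact: ler_norm.
  apply: lt_le_trans (archi_boundP _) _ => //.
  rewrite -natrX ler_nat -/K1; apply: leq_trans (ltnW (big K1)) _.
  by rewrite leq_exp2l// /K; lia.
rewrite ltr_pdivrMr// [ltRHS]mulrC -ltr_pdivrMr//.
by rewrite -mulrA; move: hK; move: (lip * _^-1) => r; lra.
Qed.

End Chain.

End Core.

Local Open Scope classical_set_scope.

(** * Hausdorff content *)

Section Content.
Variables (R : realType) (n : nat).
Implicit Types (x y c : 'rV[R]_n) (r : R).

Definition nsq x : R := \sum_(i < n) x 0 i ^+ 2.

Lemma nsq_ge0 x : 0 <= nsq x.
Proof. by apply: sumr_ge0 => i _; apply: sqr_ge0. Qed.

Lemma nsqZ (b : R) x : nsq (b *: x) = b ^+ 2 * nsq x.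
Proof. by rewrite /nsq mulr_sumr; apply: eq_bigr => i _; rewrite mxE exprMn. Qed.

Lemma enorm_ge0 x : 0 <= enorm x. Proof. exact: sqrtr_ge0. Qed.

Lemma sqr_enorm x : enorm x ^+ 2 = nsq x.
Proof. by rewrite sqr_sqrtr// nsq_ge0. Qed.

Lemma enorm_le x r : 0 <= r -> (enorm x <= r) = (nsq x <= r ^+ 2).
Proof. by move=> r0; rewrite -sqr_enorm ler_sqr// ?nnegrE ?enorm_ge0. Qed.

Lemma enorm_lt x r : 0 <= r -> (enorm x < r) = (nsq x < r ^+ 2).
Proof. by move=> r0; rewrite -sqr_enorm ltr_sqr// ?nnegrE ?enorm_ge0. Qed.

(* The bound [(a - b)^2 <= 2 a^2 + 2 b^2] replaces the triangle inequality. *)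
Lemma diam_eball_le c r : 0 < r -> (diam (eball c r) <= (2 * r)%:E)%E.
Proof.
move=> r0; apply: ge_ereal_sup => _ [x [y [xb yb ->]]].
rewrite lee_fin enorm_le; last by lra.
move: xb yb; rewrite /eball /= !enorm_lt; try lra.
move=> xb yb; apply: (@le_trans _ _ (2 * nsq (x - c) + 2 * nsq (y - c))); last by lra.
rewrite /nsq !mulr_sumr -big_split /=; apply: ler_sum => i _; rewrite !mxE.
by have := sqr_ge0 (x 0 i - c 0 i + (y 0 i - c 0 i)); nra.
Qed.

Lemma diam_eball_ge0 c r : 0 < r -> (0 <= diam (eball c r))%E.
Proof.
move=> r0; apply: ereal_sup_ubound; exists c, c.
have e0 : enorm (c - c) = 0.
  rewrite subrr /enorm big1 ?sqrtr0// => i _.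
  by rewrite mxE expr0n.
by split; rewrite /eball /= e0.
Qed.

Lemma diam_eball_poweR_le c r (alpha : R) : 0 < r -> 0 <= alpha ->
  ((diam (eball c r) `^ alpha)%E <= ((2 * r) `^ alpha)%:E)%E.
Proof.
move=> r0 a0; rewrite -poweR_EFin; apply: gt0_ler_poweR => //.
- by rewrite in_itv /= diam_eball_ge0//= leey.
- by rewrite in_itv /= lee_fin leey andbT; lra.
- exact: diam_eball_le.
Qed.

(** The list is continued by balls of radius [tl j], where (2 tl j)^alpha = e / 2^(j+1); they add at
    most [e] in total. *)
Lemma hausdorff_content_le (alpha : R) (E : set 'rV[R]_n) (s : seq ('rV[R]_n * R)) :
  0 < alpha -> (forall p, p \in s -> 0 < p.2) ->
  (forall x, E x -> exists2 p, p \in s & eball p.1 p.2 x) ->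
  (hausdorff_content alpha E <= (\sum_(p <- s) (2 * p.2) `^ alpha)%:E)%E.
Proof.
move=> a0 s0 Es; apply/lee_addgt0Pr => e e0.
pose tl (j : nat) : R := (e / (2 ^ j.+1)%:R) `^ alpha^-1 / 2.
have e2 (j : nat) : 0 < e / (2 ^ j.+1)%:R by rewrite divr_gt0// ltr0n expn_gt0.
have tl0 j : 0 < tl j by rewrite divr_gt0// powR_gt0.
pose p0 : 'rV[R]_n * R := (0, 1).
pose c j := (nth p0 s j).1.
pose r j := if (j < size s)%N then (nth p0 s j).2 else tl j.
have r0 j : 0 < r j by rewrite /r; case: ifP => // js; apply: s0; rewrite mem_nth.
pose u j : \bar R := if (j < size s)%N then ((2 * r j) `^ alpha)%:E else 0%E.
have u0 j : (0 <= u j)%E by rewrite /u; case: ifP => // _; rewrite lee_fin powR_ge0.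
apply: (@le_trans _ _ (\sum_(0 <= j <oo) (diam (eball (c j) (r j)) `^ alpha)%E)%E).
  apply: ereal_inf_lbound; exists c, r; split=> // x /Es[p ps px].
  exists (index p s) => //=.
  by rewrite /c /r index_mem ps nth_index.
apply: (@le_trans _ _ (\sum_(0 <= j <oo) (u j + (e / (2 ^ j.+1)%:R)%:E))%E).
  apply: lee_nneseries => [j _ _|j _]; first exact: poweR_ge0.
  apply: le_trans (diam_eball_poweR_le (c j) (r0 j) (ltW a0)) _.
  rewrite /u; case: ifPn => js; first by rewrite leeDl// lee_fin ltW.
  rewrite add0e lee_fin /r (negbTE js) /tl mulrC divfK ?pnatr_eq0//.
  by rewrite -powRrM mulVf ?gt_eqF// powRr1// ltW.
apply: le_trans (epsilon_trick xpredT u0 (ltW e0)) _.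
rewrite leeD2r// (nneseries_split 0%N (size s)) ?add0n; last by move=> *; exact: u0.
rewrite [X in (_ + X)%E]eseries0 ?adde0.
  rewrite (big_nth p0) -sumEFin !big_nat; apply: lee_sum => j /andP[_ js].
  by rewrite /u /r js.
by move=> j js _; rewrite /u ltnNge js.
Qed.

End Content.

(** * Stereographic projection *)

Section LipschitzOnCube.
Variables (R : realType) (d : nat).
Implicit Types (f g : ('I_d -> R) -> R) (y : 'I_d -> R).

(** Distances are measured by the largest coordinate; the bound [b] serves the product rule. *)
Definition cube_lip f := exists b l : R, [/\ 0 <= b, 0 <= l,
  forall y, (forall k, 0 <= y k <= 1) -> `|f y| <= b &
  forall (e : R) y y', 0 <= e -> (forall k, 0 <= y k <= 1) ->
    (forall k, 0 <= y' k <= 1) -> (forall k, `|y k - y' k| <= e) ->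
    `|f y - f y'| <= l * e].

Lemma cube_lip_cst (a : R) : cube_lip (fun=> a).
Proof.
exists `|a|, 0; split=> // e y y' *.
by rewrite subrr normr0 mul0r.
Qed.

Lemma cube_lip_coord i : cube_lip (fun y => y i).
Proof.
exists 1, 1; split=> // [y y01|e y y' e0 y01 y01' yy].
  by have /andP[? ?] := y01 i; rewrite ger0_norm.
by rewrite mul1r.
Qed.

Lemma cube_lipD f g : cube_lip f -> cube_lip g -> cube_lip (fun y => f y + g y).
Proof.
move=> [b [l [b0 l0 fb fl]]] [b' [l' [b0' l0' gb gl]]].
exists (b + b'), (l + l'); split; try lra.
  by move=> y y01; apply: le_trans (ler_normD _ _) (lerD (fb _ y01) (gb _ y01)).
move=> e y y' e0 h h' yy; rewrite opprD addrACA mulrDl.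
by apply: le_trans (ler_normD _ _) (lerD (fl _ _ _ e0 h h' yy) (gl _ _ _ e0 h h' yy)).
Qed.

Lemma cube_lipM f g : cube_lip f -> cube_lip g -> cube_lip (fun y => f y * g y).
Proof.
move=> [b [l [b0 l0 fb fl]]] [b' [l' [b0' l0' gb gl]]].
exists (b * b'), (l * b' + b * l'); split; try nra.
  by move=> y y01; rewrite normrM; apply: ler_pM; rewrite ?fb ?gb.
move=> e y y' e0 h h' yy.
have -> : f y * g y - f y' * g y' = (f y - f y') * g y + f y' * (g y - g y') by ring.
apply: le_trans (ler_normD _ _) _; rewrite !normrM mulrDl mulrAC -[X in _ <= _ + X]mulrA.
by apply: lerD; apply: ler_pM => //; [exact: fl|exact: gb|exact: fb|exact: gl].
Qed.

Lemma cube_lipX f n : cube_lip f -> cube_lip (fun y => f y ^+ n).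
Proof.
move=> fl; elim: n => [|n IH]; first exact: (cube_lip_cst 1).
by under eq_fun do rewrite exprS; apply: cube_lipM.
Qed.

Lemma cube_lip_sum (I : Type) (s : seq I) (F : I -> ('I_d -> R) -> R) :
  (forall i, cube_lip (F i)) -> cube_lip (fun y => \sum_(i <- s) F i y).
Proof.
move=> Fl; elim: s => [|i s IH].
  by under eq_fun do rewrite big_nil; exact: cube_lip_cst.
by under eq_fun do rewrite big_cons; apply: cube_lipD.
Qed.

Lemma cube_lip_prod (I : Type) (s : seq I) (F : I -> ('I_d -> R) -> R) :
  (forall i, cube_lip (F i)) -> cube_lip (fun y => \prod_(i <- s) F i y).
Proof.
move=> Fl; elim: s => [|i s IH].
  by under eq_fun do rewrite big_nil; exact: cube_lip_cst.
by under eq_fun do rewrite big_cons; apply: cube_lipM.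
Qed.

End LipschitzOnCube.

(** * Coefficients in a prescribed top degree *)

Section TopCoefficient.
Variable R : comNzRingType.
Implicit Types (p : {poly R}) (c : R).

(** Since [c] may vanish, this passes to products, and to sums with a common [k], without conditions
    on cancellation. *)
Definition has_top p k c := (size p <= k.+1)%N /\ p`_k = c.

Lemma has_topM p1 p2 k1 k2 c1 c2 :
  has_top p1 k1 c1 -> has_top p2 k2 c2 -> has_top (p1 * p2) (k1 + k2) (c1 * c2).
Proof.
move=> [s1 <-] [s2 <-]; split.
  apply: leq_trans (size_polyMleq _ _) _.
  by move: s1 s2; move: (size p1) (size p2) => a b; lia.
rewrite coefM (bigD1 (inord k1)) //= inordK; last by lia.
rewrite addKn big1 ?addr0// => i ik.
have [ki|ki|ki] := ltngtP k1 i.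
- by rewrite [p1`_i]nth_default ?mul0r// (leq_trans s1).
- by rewrite [p2`__]nth_default ?mulr0// (leq_trans s2)//; lia.
- by move: ik; rewrite -val_eqE /= inordK -?ki ?eqxx//; lia.
Qed.

Lemma has_topC c : has_top c%:P 0 c.
Proof. by split; [exact: size_polyC_leq1 | rewrite coefC]. Qed.

Lemma has_topX p k c n : has_top p k c -> has_top (p ^+ n) (k * n) (c ^+ n).
Proof.
move=> pc; elim: n => [|n IH]; first by rewrite muln0 !expr0; exact: has_topC.
by rewrite !exprS mulnS; apply: has_topM.
Qed.

Lemma has_top_prod (I : Type) (s : seq I) (F : I -> {poly R}) (k : I -> nat) (c : I -> R) :
  (forall i, has_top (F i) (k i) (c i)) ->
  has_top (\prod_(i <- s) F i) (\sum_(i <- s) k i) (\prod_(i <- s) c i).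
Proof.
move=> Ft; elim: s => [|i s IH]; first by rewrite !big_nil; exact: has_topC.
by rewrite !big_cons; apply: has_topM.
Qed.

Lemma has_top_sum (I : eqType) (s : seq I) (F : I -> {poly R}) k (c : I -> R) :
  (forall i, i \in s -> has_top (F i) k (c i)) ->
  has_top (\sum_(i <- s) F i) k (\sum_(i <- s) c i).
Proof.
elim: s => [|i s IH] Fc; first by rewrite !big_nil; split; rewrite ?size_poly0 ?coef0.
have [h1 h2] := Fc i (mem_head _ _).
have [] := IH => [i' is'|h3 h4]; first by apply: Fc; rewrite inE is' orbT.
rewrite !big_cons; split; last by rewrite coefD h2 h4.
by apply: leq_trans (size_polyD _ _) _; rewrite geq_max h1.
Qed.

End TopCoefficient.

(** A list of coefficients and exponents, so that the pullback can clear denominators term by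
    term. *)
Definition monomial_sum (R : realType) n (s : seq (R * {ffun 'I_n -> nat})) (x : 'rV[R]_n) : R :=
  \sum_(p <- s) p.1 * \prod_i x 0 i ^+ p.2 i.

Lemma spherical_polynomial_sum (R : realType) n N (p : 'rV[R]_n -> R) :
  spherical_polynomial N p -> exists s : seq (R * {ffun 'I_n -> nat}),
    (forall c, c \in s -> \sum_i c.2 i <= N)%N /\
    forall x, sphere n x -> p x = monomial_sum s x.
Proof.
move=> [P [PN pP]].
exists [seq (mpoly.mcoeff m P, [ffun i => mpoly.fun_of_multinom m i]) | m <- mpoly.msupp P].
split=> [_ /seq.mapP[m mP ->] /=|x /pP ->].
  under eq_bigr do rewrite ffunE; rewrite -mpoly.mdegE -ltnS.
  exact: leq_trans (mpoly.msize_mdeg_lt mP) PN.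
rewrite mpoly.mevalE /monomial_sum [RHS]big_map; apply: eq_bigr => m _.
by congr (_ * _); apply: eq_bigr => i _; rewrite ffunE.
Qed.

(** * Stereographic coordinates with pole [y0] *)

Section Stereographic.
Variables (R : realType) (d : nat) (y0 : 'rV[R]_d.+1) (k : 'I_d.+1) (L : R).
Hypothesis y0_nsq : nsq y0 = 1.
Hypothesis y0_max : forall l, `|y0 0 l| <= `|y0 0 k|.
Hypothesis L_ge1 : 1 <= L.
Implicit Types (y : 'I_d -> R) (x : 'rV[R]_d.+1).

Lemma y0k_neq0 : y0 0 k != 0.
Proof.
apply: contra_eq_neq y0_nsq => yk; rewrite /nsq big1 ?(eq_sym 0) ?oner_eq0// => l _.
have := y0_max l; rewrite yk normr0 normr_le0 => /eqP ->.
by rewrite expr0n.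
Qed.

(* The point of the hyperplane [<y0, w> = 1] with coordinates [L (2 y - 1)]
   outside [k]; the sphere minus [y0] is the image of this hyperplane under
   [w |-> y0 - 2 w / |w|^2]. *)
Definition hyper y : 'rV[R]_d.+1 := \row_l
  if unlift k l is Some i then L * (2 * y i - 1)
  else (1 - \sum_i y0 0 (lift k i) * (L * (2 * y i - 1))) / y0 0 k.

Definition stereo y : 'rV[R]_d.+1 := \row_l (y0 0 l - 2 * hyper y 0 l / nsq (hyper y)).

Lemma hyper_lift y i : hyper y 0 (lift k i) = L * (2 * y i - 1).
Proof. by rewrite mxE liftK. Qed.

Lemma hyper_k y :
  hyper y 0 k = (1 - \sum_i y0 0 (lift k i) * hyper y 0 (lift k i)) / y0 0 k.
Proof.
rewrite [LHS]mxE unlift_none; congr ((1 - _) / _).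
by apply: eq_bigr => i _; rewrite hyper_lift.
Qed.

Lemma dot_hyper y : \sum_l y0 0 l * hyper y 0 l = 1.
Proof.
rewrite (bigD1_ord k) //= hyper_k mulrC divfK ?y0k_neq0//.
by rewrite subrK.
Qed.

Lemma nsqD_dot (u v : 'rV[R]_d.+1) (b : R) :
  nsq (u + b *: v) = nsq u + 2 * b * (\sum_l u 0 l * v 0 l) + b ^+ 2 * nsq v.
Proof.
rewrite /nsq !mulr_sumr -!big_split /=; apply: eq_bigr => l _; rewrite !mxE.
by ring.
Qed.

(** Expand |y0 - w|^2 >= 0 with |y0| = 1 and <y0, w> = 1. *)
Lemma nsq_hyper_ge1 y : 1 <= nsq (hyper y).
Proof.
have := nsq_ge0 (y0 + (-1) *: hyper y); rewrite nsqD_dot dot_hyper y0_nsq.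
by lra.
Qed.

(** Since [y0] is largest in modulus at [k], solving <y0, w> = 1 for coordinate [k] involves ratios
    of modulus at most 1; this coordinate changes by at most the sum of the changes of the [d]
    others. *)
Lemma hyper_lip (e : R) y y' : 0 <= e -> (0 < d)%N -> (forall i, `|y i - y' i| <= e) ->
  nsq (hyper y - hyper y') <= (d.+1%:R * (d%:R * (2 * L * e))) ^+ 2.
Proof.
move=> e0 d0 yy; have L0 : 0 <= L := le_trans ler01 L_ge1.
have d1 : 1 <= d%:R :> R by rewrite ler1n.
have Le : 0 <= 2 * L * e by rewrite !mulr_ge0.
have hl i : `|hyper y 0 (lift k i) - hyper y' 0 (lift k i)| <= 2 * L * e.
  rewrite !hyper_lift.
  have -> : L * (2 * y i - 1) - L * (2 * y' i - 1) = 2 * L * (y i - y' i) by ring.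
  by rewrite normrM (@ger0_norm _ (2 * L)) ?mulr_ge0// ler_wpM2l// mulr_ge0.
have hB l : `|(hyper y - hyper y') 0 l| <= d%:R * (2 * L * e).
  rewrite mxE [X in `|_ + X|]mxE; case: (unliftP k l) => [i ->|->].
    by apply: le_trans (hl i) _; rewrite ler_peMl.
  have -> : hyper y 0 k - hyper y' 0 k =
     - \sum_i (y0 0 (lift k i) / y0 0 k) * (hyper y 0 (lift k i) - hyper y' 0 (lift k i)).
    rewrite !hyper_k -mulrBl opprB addrC addrA subrK.
    rewrite -sumrB -sumrN mulr_suml; apply: eq_bigr => i _.
    by field; exact: y0k_neq0.
  rewrite normrN; apply: le_trans (ler_norm_sum _ _ _) _.
  have -> : d%:R * (2 * L * e) = \sum_(i < d) (2 * L * e) by rewrite sumr_const card_ord mulr_natl.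
  apply: ler_sum => i _; rewrite normrM -[leRHS]mul1r; apply: ler_pM => //.
  by rewrite normf_div ler_pdivrMr ?normr_gt0 ?y0k_neq0// mul1r.
set B := d%:R * _ in hB *.
have B0 : 0 <= B by rewrite mulr_ge0.
apply: (@le_trans _ _ (\sum_(l < d.+1) B ^+ 2)).
  by apply: ler_sum => l _; rewrite -real_normK ?num_real// lerXn2r ?nnegrE.
rewrite sumr_const card_ord -[leLHS]mulr_natl [leRHS]exprMn ler_wpM2r ?sqr_ge0//.
by rewrite expr2 ler_peMl// ler1n.
Qed.

(** The classical distance formula for the inversion in the unit sphere. *)
Lemma nsq_inversion (u v : 'rV[R]_d.+1) : nsq u != 0 -> nsq v != 0 ->
  nsq ((nsq u)^-1 *: u - (nsq v)^-1 *: v) = nsq (u - v) / (nsq u * nsq v).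
Proof.
move=> u0 v0.
rewrite -(scaleN1r v) nsqD_dot -scaleNr nsqD_dot nsqZ.
have -> : \sum_l ((nsq u)^-1 *: u) 0 l * v 0 l = (nsq u)^-1 * \sum_l u 0 l * v 0 l.
  by rewrite mulr_sumr; apply: eq_bigr => l _; rewrite mxE mulrA.
by field; rewrite u0 v0.
Qed.

(** Up to a translation and the factor -2, [stereo] is [hyper] followed by the inversion, which does
    not increase distances outside the open unit ball, where the hyperplane lies. *)
Lemma stereo_lip (e : R) y y' : 0 <= e -> (0 < d)%N -> (forall i, `|y i - y' i| <= e) ->
  enorm (stereo y - stereo y') <= 4 * d.+1%:R * d%:R * L * e.
Proof.
move=> e0 d0 yy.
rewrite enorm_le ?mulr_ge0//; last exact: le_trans ler01 L_ge1.
have h := hyper_lip e0 d0 yy.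
have w1 := nsq_hyper_ge1 y; have w1' := nsq_hyper_ge1 y'.
have -> : stereo y - stereo y' = (-2) *: ((nsq (hyper y))^-1 *: hyper y
   - (nsq (hyper y'))^-1 *: hyper y').
  by apply/rowP => l; rewrite !mxE; ring.
rewrite nsqZ nsq_inversion ?gt_eqF//; try lra.
have -> : (4 * d.+1%:R * d%:R * L * e) ^+ 2 = (-2) ^+ 2 * (d.+1%:R * (d%:R * (2 * L * e))) ^+ 2 by ring.
rewrite ler_wpM2l ?sqr_ge0//; apply: le_trans h.
rewrite ler_pdivrMr; last by rewrite mulr_gt0//; lra.
by rewrite ler_peMr ?nsq_ge0//; nra.
Qed.

(* The preimage of [x] is [w = 2 (y0 - x) / |y0 - x|^2]. *)
Lemma stereo_surj x (rho : R) : 0 < rho -> 2 / rho < L -> nsq x = 1 -> rho <= enorm (x - y0) ->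
  exists y, [/\ forall i, 0 <= y i < 1, stereo y = x & nsq (hyper y) <= (2 / rho) ^+ 2].
Proof.
move=> rho0 rhoL x1 xrho; pose v := y0 - x.
have vE : nsq v = nsq (x - y0).
  by rewrite /nsq; apply: eq_bigr => l _; rewrite !mxE; ring.
have vrho : rho ^+ 2 <= nsq v.
  by rewrite vE -sqr_enorm lerXn2r ?nnegrE ?enorm_ge0// ltW.
have v0 : 0 < nsq v by apply: lt_le_trans vrho; rewrite exprn_gt0.
pose w := (2 / nsq v) *: v.
have wE : nsq w = 4 / nsq v.
  by rewrite nsqZ; field; rewrite gt_eqF.
have wle : nsq w <= (2 / rho) ^+ 2.
  rewrite wE exprMn exprVn expr2 (_ : 2 * 2 = 4 :> R); last by ring.
  by rewrite ler_wpM2l// lef_pV2// posrE// exprn_gt0.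
have dotw : \sum_l y0 0 l * w 0 l = 1.
  have -> : \sum_l y0 0 l * w 0 l = (2 / nsq v) * \sum_l y0 0 l * v 0 l.
    by rewrite mulr_sumr; apply: eq_bigr => l _; rewrite mxE; ring.
  have h : nsq x = nsq y0 + 2 * (-1) * (\sum_l y0 0 l * v 0 l) + (-1) ^+ 2 * nsq v.
    by rewrite -nsqD_dot; congr nsq; apply/rowP => l; rewrite !mxE; ring.
  have -> : \sum_l y0 0 l * v 0 l = nsq v / 2 by rewrite x1 y0_nsq in h; lra.
  by field; rewrite gt_eqF.
(* The inverse of [hyper_lift]; it lands in [0, 1) because |w| <= 2 / rho < L. *)
pose y i := (w 0 (lift k i) / L + 1) / 2.
have L0 : 0 < L := lt_le_trans ltr01 L_ge1.
have hw : hyper y = w.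
  have hwl i : hyper y 0 (lift k i) = w 0 (lift k i).
    by rewrite hyper_lift /y; field; rewrite gt_eqF.
  apply/rowP => l; case: (unliftP k l) => [i ->|->]; first exact: hwl.
  rewrite hyper_k; under eq_bigr do rewrite hwl.
  move: dotw; rewrite (bigD1_ord k) //= => <-.
  by rewrite addrK mulrC mulKf ?y0k_neq0.
exists y; split; last by rewrite hw.
  move=> i; suff : `|w 0 (lift k i) / L| < 1 by rewrite /y ltr_norml => /andP[? ?]; apply/andP; lra.
  rewrite normrM normfV (gtr0_norm L0) ltr_pdivrMr// mul1r.
  have r0 : 0 <= 2 / rho by rewrite divr_ge0// ltW.
  apply: le_lt_trans rhoL; rewrite -ler_sqr ?nnegrE//.
  apply: le_trans wle; rewrite real_normK ?num_real//.
  by rewrite /nsq (bigD1 (lift k i))//= lerDl sumr_ge0// => l _; exact: sqr_ge0.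
apply/rowP => l; rewrite mxE hw wE !mxE.
by field; rewrite gt_eqF.
Qed.

End Stereographic.

(** * The pullback of a spherical polynomial *)

Section Lift.
Variables (R : realType) (d : nat) (y0 : 'rV[R]_d.+1) (k : 'I_d.+1) (L : R).
Hypothesis y0_nsq : nsq y0 = 1.
Hypothesis y0_max : forall l, `|y0 0 l| <= `|y0 0 k|.
Hypothesis L_ge1 : 1 <= L.
Variables (N : nat) (s : seq (R * {ffun 'I_d.+1 -> nat})).
Hypothesis sN : (forall c, c \in s -> \sum_i c.2 i <= N)%N.

Local Notation hyper := (hyper y0 k L).
Local Notation stereo := (stereo y0 k L).

(* The spherical polynomial pulled back by [stereo], with its denominator
   [nsq (hyper y) ^+ N] cleared. *)
Definition pullback (y : 'I_d -> R) : R :=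
  \sum_(c <- s) c.1 * nsq (hyper y) ^+ (N - \sum_i c.2 i) *
    \prod_l (nsq (hyper y) * y0 0 l - 2 * hyper y 0 l) ^+ c.2 l.

Lemma pullbackE y : pullback y = nsq (hyper y) ^+ N * monomial_sum s (stereo y).
Proof.
rewrite /pullback /monomial_sum mulr_sumr big_seq [RHS]big_seq; apply: eq_bigr => c cs.
have n0 : nsq (hyper y) != 0.
  by rewrite gt_eqF// (lt_le_trans ltr01)// nsq_hyper_ge1.
rewrite -{2}(subnK (sN cs)) exprD -prodrXr.
have -> : \prod_l (nsq (hyper y) * y0 0 l - 2 * hyper y 0 l) ^+ c.2 l =
    (\prod_l nsq (hyper y) ^+ c.2 l) * (\prod_l stereo y 0 l ^+ c.2 l).
  rewrite -big_split /=; apply: eq_bigr => l _; rewrite -exprMn; congr (_ ^+ _).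
  by rewrite [stereo _ _ _]mxE; field.
by ring.
Qed.

(** The derivative of coordinate [l] of [hyper] in direction [i]. *)
Definition slope (i : 'I_d) (l : 'I_d.+1) : R :=
  if l == lift k i then 2 * L
  else if l == k then - (y0 0 (lift k i) * (2 * L)) / y0 0 k else 0.

Lemma hyper_update y i t l :
  hyper (update y i t) 0 l = hyper (update y i 0) 0 l + slope i l * t.
Proof.
rewrite /slope; case: (unliftP k l) => [i' ->|->].
  rewrite !hyper_lift /update (inj_eq lift_inj); case: eqVneq => _; first by ring.
  by rewrite eq_sym (negPf (neq_lift _ _)) mul0r addr0.
rewrite (negPf (neq_lift k i)) eqxx !hyper_k !(bigD1 i (P := xpredT)) //= !hyper_lift.
rewrite {1 3}/update eqxx.
have -> : \sum_(j < d | j != i) y0 0 (lift k j) * hyper (update y i t) 0 (lift k j) =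
          \sum_(j < d | j != i) y0 0 (lift k j) * hyper (update y i 0) 0 (lift k j).
  by apply: eq_bigr => j ji; rewrite !hyper_lift /update (negPf ji).
by field; exact: y0k_neq0 y0_nsq y0_max.
Qed.

(** On the line, G = |w|^2 has coefficient [g] at t^2, and V l has coefficient g y0_l there because
    W l is affine. So each summand has degree at most 2N, and the coefficients of t^(2N) add up to
    g^N p(y0), with g >= 1: at infinity, every line tends to the pole. *)
Lemma pullback_line y i : monomial_sum s y0 != 0 -> exists F : {poly R},
  [/\ size F = (2 * N).+1, `|monomial_sum s y0| <= `|lead_coef F| &
      forall t, pullback (update y i t) = F.[t]].
Proof.
move=> P0.
pose W l : {poly R} := (hyper (update y i 0) 0 l)%:P + slope i l *: 'X.
have WE t l : (W l).[t] = hyper (update y i t) 0 l.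
  by rewrite /W hornerD hornerC hornerZ hornerX [RHS]hyper_update.
have Wtop l : has_top (W l) 1 (slope i l).
  split; last by rewrite coefD coefC coefZ coefX /= mulr1 add0r.
  apply: leq_trans (size_polyD _ _) _; rewrite geq_max.
  rewrite (leq_trans (size_polyC_leq1 _))//=.
  by apply: leq_trans (size_scale_leq _ _) _; rewrite size_polyX.
pose G : {poly R} := \sum_l W l ^+ 2.
pose g := \sum_l slope i l ^+ 2.
have GE t : G.[t] = nsq (hyper (update y i t)).
  by rewrite /G horner_sum /nsq; apply: eq_bigr => l _; rewrite horner_exp WE.
have Gtop : has_top G 2 g.
  by apply: has_top_sum => l _; have := has_topX 2 (Wtop l).
have g1 : 1 <= g.
  rewrite /g (bigD1 (lift k i))//= {1}/slope eqxx.
  have : 0 <= \sum_(l < d.+1 | l != lift k i) slope i l ^+ 2.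
    by apply: sumr_ge0 => l _; exact: sqr_ge0.
  have := L_ge1; set S := \sum_(_ | _) _; nra.
pose V l : {poly R} := G * (y0 0 l)%:P - 2%:P * W l.
have VE t l : (V l).[t] = nsq (hyper (update y i t)) * y0 0 l - 2 * hyper (update y i t) 0 l.
  by rewrite /V hornerD hornerN !hornerM !hornerC GE WE.
have Vtop l : has_top (V l) 2 (g * y0 0 l).
  have [h1 h2] := has_topM Gtop (has_topC (y0 0 l)).
  have [h3 h4] := has_topM (has_topC (2 : R)) (Wtop l).
  split; last by rewrite coefB h2 [X in _ - X]nth_default ?subr0// (leq_trans h3).
  by apply: leq_trans (size_polyD _ _) _; rewrite geq_max size_polyN h1 (leq_trans h3).
pose F : {poly R} := \sum_(c <- s) c.1%:P * G ^+ (N - \sum_i c.2 i) * \prod_l V l ^+ c.2 l.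
have Ftop : has_top F (2 * N)
    (\sum_(c <- s) c.1 * g ^+ (N - \sum_i c.2 i) * \prod_l (g * y0 0 l) ^+ c.2 l).
  apply: has_top_sum => c cs.
  have -> : (2 * N = 0 + 2 * (N - \sum_i c.2 i) + \sum_i 2 * c.2 i)%N.
    by rewrite -big_distrr /= add0n -mulnDr subnK// sN.
  apply: has_topM; last by apply: has_top_prod => l; exact: has_topX.
  by apply: has_topM; [exact: has_topC | exact: has_topX].
have cE : \sum_(c <- s) c.1 * g ^+ (N - \sum_i c.2 i) * \prod_l (g * y0 0 l) ^+ c.2 l
    = g ^+ N * monomial_sum s y0.
  rewrite /monomial_sum mulr_sumr big_seq [RHS]big_seq; apply: eq_bigr => c cs.
  rewrite -{2}(subnK (sN cs)) exprD -prodrXr.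
  have -> : \prod_l (g * y0 0 l) ^+ c.2 l =
      (\prod_l g ^+ c.2 l) * (\prod_l y0 0 l ^+ c.2 l).
    by rewrite -big_split /=; apply: eq_bigr => l _; rewrite exprMn.
  by ring.
rewrite cE in Ftop.
have gN : 1 <= g ^+ N by rewrite exprn_ege1.
have [h1 h2] := Ftop.
have sF : size F = (2 * N).+1.
  apply/eqP; rewrite eqn_leq h1 /= ltnNge; apply/negP => /leq_sizeP/(_ (2 * N)%N (leqnn _)).
  rewrite h2 => /eqP; rewrite mulf_eq0 (negPf P0) orbF gt_eqF//.
  exact: lt_le_trans gN.
exists F; split=> //.
  rewrite lead_coefE sF /= h2 normrM ger0_norm; last exact: le_trans gN.
  by rewrite ler_peMl.
move=> t; rewrite /F /pullback horner_sum; apply: eq_bigr => c _.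
rewrite !hornerM hornerC horner_exp GE horner_prod; congr (_ * _).
by apply: eq_bigr => l _; rewrite horner_exp VE.
Qed.

Lemma pullback_lip : cube_lip pullback.
Proof.
have hl l : cube_lip (fun y => hyper y 0 l).
  have hlift i : cube_lip (fun y => hyper y 0 (lift k i)).
    under eq_fun do rewrite hyper_lift mulrDr.
    apply: cube_lipD; last exact: cube_lip_cst.
    do 2 (apply: cube_lipM; first exact: cube_lip_cst).
    exact: cube_lip_coord.
  case: (unliftP k l) => [i ->|->]; first exact: hlift.
  under eq_fun do rewrite hyper_k; apply: cube_lipM; last exact: cube_lip_cst.
  apply: cube_lipD; first exact: cube_lip_cst.
  under eq_fun do rewrite -sumrN.
  apply: cube_lip_sum => i; under eq_fun do rewrite -mulNr.
  by apply: cube_lipM => //; exact: cube_lip_cst.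
have nl : cube_lip (fun y => nsq (hyper y)).
  by apply: cube_lip_sum => l; exact: cube_lipX.
apply: cube_lip_sum => c; apply: cube_lipM.
  by apply: cube_lipM; [exact: cube_lip_cst | exact: cube_lipX].
apply: cube_lip_prod => l; apply/cube_lipX/cube_lipD.
  by apply: cube_lipM => //; exact: cube_lip_cst.
under eq_fun do rewrite -mulNr.
by apply: cube_lipM => //; exact: cube_lip_cst.
Qed.

End Lift.

(** * Choice of the scales *)

Lemma geometric_sum_le (R : realType) (x : R) m n : 0 <= x -> x < 1 ->
  \sum_(m <= j < n) x ^+ j <= x ^+ m / (1 - x).
Proof.
move=> x0 x1; have x1' : 0 < 1 - x by lra.
have [nm|mn] := leqP n m; first by rewrite big_geq// divr_ge0 ?exprn_ge0// ltW.
have -> : \sum_(m <= j < n) x ^+ j = (x ^+ m - x ^+ n) / (1 - x).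
  apply: (mulIf (lt0r_neq0 x1')); rewrite divfK ?gt_eqF//.
  elim: n mn => // n IH; rewrite ltnS leq_eqVlt => /orP[/eqP <-|mn].
    by rewrite big_nat1 exprS; ring.
  by rewrite big_nat_recr ?(ltnW mn)//= mulrDl IH// exprS; ring.
by rewrite ler_pM2r ?invr_gt0// gerBl exprn_ge0.
Qed.

Lemma dyadic_approx (R : realType) (X : R) : 1 <= X -> exists j : nat, X <= 2 ^+ j <= 2 * X.
Proof.
move=> X1; have ex : exists j, X <= 2 ^+ j :> R.
  exists (Num.bound X); apply/ltW/(lt_le_trans (archi_boundP (le_trans ler01 X1))).
  by rewrite -natrX ler_nat ltnW// ltn_expl.
case: (ex_minnP ex) => -[|j] jX jmin; first by exists 0%N; rewrite jX expr0; lra.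
exists j.+1; rewrite jX exprS ler_pM2l//= leNgt; apply/negP => /ltW/jmin.
by rewrite ltnn.
Qed.

Lemma double_count_le (D b : nat) : (0 < D)%N -> (0 < b)%N ->
  (D * (D * b).*2.+1 <= 3 * D ^ 2 * b)%N.
Proof.
move=> D0 b0; rewrite mulnS -doubleMr mulnA mulnn -[leqRHS]mulnA.
have : (D <= D ^ 2 * b)%N by rewrite -mulnn -mulnA leq_pmulr// muln_gt0 D0.
by move: (D ^ 2 * b)%N => e; lia.
Qed.

(** * The covering argument and the bound at a point *)

Section Pointwise.
Variables (R : realType) (d : nat) (delta h : R) (M : set 'rV[R]_d.+1).
Hypothesis d_gt0 : (0 < d)%N.
Hypothesis delta_gt0 : 0 < delta.
Hypothesis delta_lt1 : delta < 1.
Hypothesis M_sphere : M `<=` sphere d.+1.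
Hypothesis h_gt0 : 0 < h.
Let alpha : R := d%:R - 1 + delta.
Hypothesis M_content : (h%:E <= hausdorff_content alpha M)%E.

Let alpha_gt0 : 0 < alpha.
Proof. by have : 1 <= d%:R :> R; [rewrite ler1n|rewrite /alpha; move: delta_gt0; lra]. Qed.

(** The ball of radius [rho] around [y0], treated apart from the chart, costs half of the content
    bound [h]. *)
Let rho : R := (h / 2) `^ alpha^-1 / 2.
Let rho_gt0 : 0 < rho. Proof. by rewrite divr_gt0// powR_gt0// divr_gt0. Qed.
Let rhoE : (2 * rho) `^ alpha = h / 2.
Proof.
rewrite /rho mulrC divfK ?pnatr_eq0// -powRrM mulVf ?gt_eqF// powRr1//.
by rewrite divr_ge0// ltW.
Qed.

Let L : R := 2 / rho + 1.
Let L_ge1 : 1 <= L. Proof. by rewrite lerDr divr_ge0// ltW. Qed.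
Let rho_L : 2 / rho < L. Proof. by rewrite ltrDl. Qed.

(** A Lipschitz constant of [stereo], increased by 1 so that open balls of radius C / 2^j contain
    the images of closed cubes of side 2^-j around the images of their corners. *)
Let C : R := 4 * d.+1%:R * d%:R * L + 1.
Let C_gt0 : 0 < C.
Proof. by rewrite ltr_pwDr// !mulr_ge0// (le_trans ler01 L_ge1). Qed.

(** With a_j of order 2^(theta j), there are about a_j 2^(j(d-1)) rough cells of scale [j], of cost
    about 2^(-j(d-1+delta)) each; together they cost about 2^(-beta j). This [beta] makes 1 + 2/beta
    equal to 4/delta - 1, and delta < 1 gives theta > 0. *)
Let beta : R := delta / (2 - delta).
Let theta : R := delta - beta.
Let beta_gt0 : 0 < beta. Proof. by rewrite divr_gt0//; move: delta_lt1; lra. Qed.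
Let theta_gt0 : 0 < theta.
Proof. by rewrite subr_gt0 ltr_pdivrMr; move: delta_gt0 delta_lt1; nra. Qed.

Let base_theta : R := 2 `^ theta.
Let base_beta : R := 2 `^ beta.

Let powR2_gt1 (x : R) : 0 < x -> 1 < 2 `^ x.
Proof.
move=> x0; have : 1 `^ x < 2 `^ x.
  by apply: gt0_ltr_powR; rewrite ?nnegrE ?ltr1n.
by rewrite powR1.
Qed.
Let base_theta_gt1 : 1 < base_theta. Proof. exact: powR2_gt1. Qed.
Let base_beta_gt1 : 1 < base_beta. Proof. exact: powR2_gt1. Qed.

(** Gives the geometric series that dominates the d / a_j the sum 1/2. *)
Let Ca : R := 2 * d%:R / (1 - base_theta^-1).
Let a (j : nat) : nat := (Num.truncn (Ca * base_theta ^+ j)).+1.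

Let base_theta_inv : 0 < base_theta^-1 < 1.
Proof.
by have t0 : 0 < base_theta := lt_trans ltr01 base_theta_gt1; rewrite invr_gt0 t0 invf_lt1.
Qed.

Let Ca_gt0 : 0 < Ca.
Proof. by have /andP[? ?] := base_theta_inv; rewrite divr_gt0 ?mulr_gt0 ?ltr0n//; lra. Qed.

Let a_ge j : Ca * base_theta ^+ j <= (a j)%:R.
Proof. by apply/ltW; rewrite truncnS_gt. Qed.

Let a_le j : (a j)%:R <= (Ca + 1) * base_theta ^+ j.
Proof.
have t1 : 1 <= base_theta ^+ j by rewrite exprn_ege1// ltW.
rewrite /a -natr1 mulrDl mul1r lerD// truncn_le mulr_ge0//; last by lra.
exact: ltW.
Qed.

Let sum_a n : \sum_(0 <= j < n) (d%:R / (a j)%:R) <= 2^-1 :> R.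
Proof.
have /andP[t0 t1] := base_theta_inv.
have t2 : 0 < 1 - base_theta^-1 by lra.
apply: (@le_trans _ _ (\sum_(0 <= j < n) d%:R / Ca * base_theta^-1 ^+ j)).
  apply: ler_sum => j _; rewrite -mulrA ler_wpM2l// exprVn -invfM.
  rewrite lef_pV2 ?posrE ?ltr0n// mulr_gt0// exprn_gt0//.
  by rewrite (lt_trans ltr01).
rewrite -mulr_sumr; have /(_ n) g := geometric_sum_le 0 _ (ltW t0) t1.
apply: le_trans (ler_wpM2l _ g) _; first by rewrite divr_ge0// ltW.
rewrite expr0 /Ca; move: t2; move: (1 - _) => x x0.
have dn : d%:R != 0 :> R by rewrite pnatr_eq0 -lt0n.
rewrite le_eqVlt; apply/orP; left; apply/eqP; field.
by rewrite dn gt_eqF.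
Qed.

Let C1 : R := (2 ^ d.+2 * d)%:R * 3 * (Ca + 1) * (2 * C) `^ alpha.
Let C1_gt0 : 0 < C1.
Proof.
apply: mulr_gt0; last by rewrite powR_gt0// mulr_gt0.
apply: mulr_gt0; last by rewrite addr_gt0.
by rewrite mulr_gt0// ltr0n muln_gt0 expn_gt0.
Qed.

Let powR2 (x : R) j : (2 `^ x) ^+ j = (2 ^+ j) `^ x.
Proof.
by rewrite -powR_mulrn ?powR_ge0// -powRrM mulrC powRrM powR_mulrn.
Qed.

(** Write alpha = (d - 1) + theta + beta: the first part cancels the number of cells, the second
    cancels the growth of a_j, and the third remains. *)
Let scale_sum_le D j : (0 < D)%N ->
  (2 ^ d.+2 * d * (D * (D * a j).*2.+1) * (2 ^ j) ^ d.-1)%:R * (2 * (C / 2 ^+ j)) `^ alpha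
  <= C1 * D%:R ^+ 2 * base_beta^-1 ^+ j.
Proof.
move=> D0.
have j0 : 0 < 2 ^+ j :> R by rewrite exprn_gt0.
have b0 : 0 < base_beta by rewrite (lt_trans ltr01).
have t0 : 0 < base_theta by rewrite (lt_trans ltr01).
have -> : (2 * (C / 2 ^+ j)) `^ alpha = (2 * C) `^ alpha / ((2 ^+ j) ^+ d.-1 * (base_theta ^+ j * base_beta ^+ j)).
  rewrite mulrA powRM ?invr_ge0 ?mulr_ge0 ?ltW//; congr (_ * _).
  have -> : alpha = d.-1%:R + (theta + beta).
    by rewrite /alpha /theta subrK -[d in LHS](prednK d_gt0) -natr1 addrK.
  have jN0 : 2 ^+ j != 0 :> R by rewrite gt_eqF.
  rewrite -powR_inv1 ?ltW// -powRrM mulN1r powRN; congr (_^-1).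
  by rewrite powRD ?jN0 ?implybT// powRD ?jN0 ?implybT// powR_mulrn ?ltW// !powR2.
have -> : (2 ^ d.+2 * d * (D * (D * a j).*2.+1) * (2 ^ j) ^ d.-1)%:R =
   (2 ^ d.+2 * d)%:R * (D * (D * a j).*2.+1)%:R * (2 ^+ j) ^+ d.-1 :> R.
  by rewrite natrM [in LHS]natrM !natrX.
have : (D * (D * a j).*2.+1)%:R <= 3 * D%:R ^+ 2 * ((Ca + 1) * base_theta ^+ j) :> R.
  apply: (@le_trans _ _ (3 * D%:R ^+ 2 * (a j)%:R)).
    rewrite -natrX -!natrM ler_nat.
    exact: double_count_le.
  by rewrite ler_wpM2l// mulr_ge0// exprn_ge0.
set Y := _%:R => hY.
set P := (2 ^+ j) ^+ _; have P0 : 0 < P by rewrite exprn_gt0.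
set Q := (2 * C) `^ alpha; have Q0 : 0 <= Q by exact: powR_ge0.
have tj : 0 < base_theta ^+ j by rewrite exprn_gt0.
have bj : 0 < base_beta ^+ j by rewrite exprn_gt0.
have -> : (2 ^ d.+2 * d)%:R * Y * P * (Q / (P * (base_theta ^+ j * base_beta ^+ j))) =
   (2 ^ d.+2 * d)%:R * Q / base_beta ^+ j / base_theta ^+ j * Y by field; rewrite !gt_eqF.
have -> : C1 * D%:R ^+ 2 * base_beta^-1 ^+ j =
  (2 ^ d.+2 * d)%:R * Q / base_beta ^+ j / base_theta ^+ j * (3 * D%:R ^+ 2 * ((Ca + 1) * base_theta ^+ j)).
  by rewrite exprVn /C1 -/Q; field; rewrite !gt_eqF.
by rewrite ler_wpM2l// !divr_ge0 ?mulr_ge0// ltW.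
Qed.

(** If 2^(beta j0) >= C3 D^2, the scales from [j0] on cost less than h / 2. The summand 1 gives
    [C3_ge1], on which the use of [dyadic_approx] relies. *)
Let C3 : R := 4 * C1 / ((1 - base_beta^-1) * h) + 1.

Let base_beta_inv : 0 < base_beta^-1 < 1.
Proof.
by have b0 : 0 < base_beta := lt_trans ltr01 base_beta_gt1; rewrite invr_gt0 b0 invf_lt1.
Qed.

Let C3_ge1 : 1 <= C3.
Proof.
have /andP[b0 b1] := base_beta_inv.
rewrite lerDr; apply: divr_ge0; first by rewrite mulr_ge0// ltW.
by apply: mulr_ge0; [rewrite subr_ge0 ltW | exact: ltW].
Qed.

Let total_lt D j0 K : (0 < D)%N -> (C3 * D%:R ^+ 2) `^ beta^-1 <= 2 ^+ j0 ->
  h / 2 + \sum_(j0 <= j < K) (C1 * D%:R ^+ 2 * base_beta^-1 ^+ j) < h.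
Proof.
move=> D0 Dj.
have D1 : 1 <= D%:R ^+ 2 :> R by rewrite exprn_ege1// ler1n.
have /andP[b0 b1] := base_beta_inv.
have y0 : 0 <= C3 * D%:R ^+ 2 by rewrite mulr_ge0// (le_trans ler01).
have bj : C3 * D%:R ^+ 2 <= base_beta ^+ j0.
  rewrite powR2; apply: (@le_trans _ _ (((C3 * D%:R ^+ 2) `^ beta^-1) `^ beta)).
    by rewrite -powRrM mulVf ?gt_eqF// powRr1.
  by apply: ge0_ler_powR; rewrite ?nnegrE ?powR_ge0 ?exprn_ge0// ltW.
have g := geometric_sum_le j0 K (ltW b0) b1.
suff : \sum_(j0 <= j < K) (C1 * D%:R ^+ 2 * base_beta^-1 ^+ j) < h / 2 by lra.
rewrite -mulr_sumr; have CD : 0 <= C1 * D%:R ^+ 2 by rewrite mulr_ge0// ?(ltW C1_gt0)// (le_trans ler01).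
apply: le_lt_trans (ler_wpM2l CD g) _.
set x := 1 - base_beta^-1 in g *; have x0 : 0 < x by rewrite subr_gt0.
have bj0 : 0 < base_beta ^+ j0 by rewrite exprn_gt0// (lt_trans ltr01).
rewrite exprVn.
have -> : C1 * D%:R ^+ 2 * (base_beta ^- j0 / x) = C1 * D%:R ^+ 2 / x / base_beta ^+ j0.
  by field; rewrite !gt_eqF.
rewrite ltr_pdivrMr//; apply: lt_le_trans (ler_wpM2l _ bj); last by rewrite divr_ge0// ltW.
rewrite /C3 -/x.
have -> : h / 2 * ((4 * C1 / (x * h) + 1) * D%:R ^+ 2) =
  C1 * D%:R ^+ 2 / x + (C1 / x + h / 2) * D%:R ^+ 2.
  by field; rewrite !gt_eqF.
rewrite ltrDl mulr_gt0//; last exact: lt_le_trans D1.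
by rewrite addr_gt0// divr_gt0.
Qed.

Let M_nonempty : exists x, M x.
Proof.
apply: contrapT => /forallNP M0.
have : (hausdorff_content alpha M <= 0%:E)%E.
  have := @hausdorff_content_le _ _ alpha M [::] alpha_gt0.
  by rewrite big_nil; apply=> // x /M0.
by move=> /(le_trans M_content); rewrite lee_fin leNgt h_gt0.
Qed.

(** [b] holds block indices of scale [j], hence the denominator 2^j rather than 2^K. *)
Let corner K j (b : {ffun 'I_d -> 'I_(2 ^ K)}) : 'I_d -> R := fun i => (b i)%:R / 2 ^+ j.

(** Otherwise the ball around [y0] and one ball for each cell would cover [M] at a cost below
    [h]. *)
Let cells_miss (y0 : 'rV[R]_d.+1) k D j0 K (B : nat -> {set {ffun 'I_d -> 'I_(2 ^ K)}}) :
  nsq y0 = 1 -> (forall l, `|y0 0 l| <= `|y0 0 k|) -> (0 < D)%N ->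
  (C3 * D%:R ^+ 2) `^ beta^-1 <= 2 ^+ j0 ->
  (forall j, (j0 <= j < K)%N -> #|B j| <=
      2 ^ d.+2 * d * (D * (D * a j).*2.+1) * (2 ^ j) ^ d.-1)%N ->
  exists y : 'I_d -> R, [/\ forall i, 0 <= y i < 1, M (stereo y0 k L y) &
                nsq (hyper y0 k L y) <= (2 / rho) ^+ 2] /\
    forall j, (j0 <= j < K)%N -> forall b, b \in B j ->
      ~ (forall i, (b i)%:R <= 2 ^+ j * y i < (b i)%:R + 1).
Proof.
move=> y01 ymax D0 Dj Bc; apply: contrapT => /forallNP cov.
pose s := (y0, rho) :: flatten [seq [seq (stereo y0 k L (corner j b), C / 2 ^+ j)
   | b <- enum (B j)] | j <- index_iota j0 K].
have j0' j : 0 < 2 ^+ j :> R by rewrite exprn_gt0.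
have := @hausdorff_content_le _ _ alpha M s alpha_gt0.
have s0 : forall p, p \in s -> 0 < p.2.
  move=> p; rewrite inE => /orP[/eqP -> //|/flattenP[_ /mapP[j _ ->] /mapP[b _ ->]]] /=.
  by rewrite divr_gt0.
have Ms x : M x -> exists2 p, p \in s & eball p.1 p.2 x.
  move=> Mx; have [xy|xy] := ltP (enorm (x - y0)) rho.
    by exists (y0, rho); rewrite ?mem_head.
  have x1 : nsq x = 1 by rewrite -sqr_enorm M_sphere// expr1n.
  have [y [yi yx yn]] := stereo_surj y01 ymax L_ge1 rho_gt0 rho_L x1 xy.
  have [j [jK [b [bB yb]]]] : exists j, (j0 <= j < K)%N /\ exists b, b \in B j /\
      forall i, (b i)%:R <= 2 ^+ j * y i < (b i)%:R + 1.
    apply: contrapT => nex; apply: (cov y); split; first by split; rewrite ?yx.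
    by move=> j jK b bB yb; apply: nex; exists j; split=> //; exists b.
  exists (stereo y0 k L (corner j b), C / 2 ^+ j).
    rewrite inE; apply/orP; right; apply/flattenP.
    exists [seq (stereo y0 k L (corner j b), C / 2 ^+ j) | b <- enum (B j)].
      by apply/mapP; exists j => //; rewrite mem_index_iota.
    by apply/mapP; exists b => //; rewrite mem_enum.
  rewrite /eball /= -yx.
  have e0 : 0 <= (2 ^+ j)^-1 :> R by rewrite invr_ge0 ltW.
  apply: le_lt_trans (stereo_lip y01 ymax L_ge1 e0 d_gt0 _) _.
    move=> i; rewrite /corner; have /andP[h1 h2] := yb i.
    rewrite -(ler_pM2l (j0' j)) mulfV ?gt_eqF// -{1}(gtr0_norm (j0' j)) -normrM mulrBr.
    by rewrite mulrCA mulfV ?gt_eqF// mulr1 ler_norml; lra.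
  by rewrite ltr_pM2r ?invr_gt0// ltrDl.
have -> : \sum_(p <- s) (2 * p.2) `^ alpha =
    h / 2 + \sum_(j0 <= j < K) #|B j|%:R * (2 * (C / 2 ^+ j)) `^ alpha.
  rewrite big_cons /= rhoE big_flatten big_map; congr (_ + _).
  apply: eq_bigr => j _; rewrite big_map /= big_enum /= sumr_const.
  by rewrite -[LHS]mulr_natl.
move=> /(_ s0 Ms)/(le_trans M_content); rewrite lee_fin leNgt => /negP; apply.
apply: le_lt_trans (total_lt K D0 Dj); rewrite lerD2l big_nat [leRHS]big_nat.
apply: ler_sum => j jK; apply: le_trans (scale_sum_le j D0).
by rewrite ler_wpM2r ?powR_ge0// ler_nat Bc.
Qed.

Let e : R := 4 / delta - 1.
(** 128 / rho collects the factor 2 of [lead_coef_le] (as 2 <= 2^D), the bound 2 / rho, the 16 of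
    the base step and the 2 lost by rounding to a power of 2; 2^e comes from D = 2N. *)
Let Kremez : R := 128 / rho * C3 `^ beta^-1 * 2 `^ e.

Let eE : e = 1 + 2 / beta.
Proof. by rewrite /e /beta; field; rewrite !gt_eqF//; move: delta_lt1; lra. Qed.

(** [lead_coef_le] with D = 2N bounds |p(y0)| by 2 (2/rho)^D m (16 D 2^j0)^D. As 2^j0 is of order
    D^(2/beta), the base is of order D^(1 + 2/beta). The constant is the same for all [y0]. *)
Lemma remez_pointwise : exists Kc : R, 0 < Kc /\
  forall N (s : seq (R * {ffun 'I_d.+1 -> nat})) (m : R), (0 < N)%N ->
    (forall c, c \in s -> \sum_i c.2 i <= N)%N ->
    (forall x, M x -> `|monomial_sum s x| <= m) ->
    forall y0, sphere d.+1 y0 ->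
      `|monomial_sum s y0| <= (Kc * N%:R `^ (4 / delta - 1)) ^+ (2 * N) * m.
Proof.
have C30 : 0 < C3 := lt_le_trans ltr01 C3_ge1.
exists Kremez; split; first by rewrite !mulr_gt0 ?invr_gt0 ?powR_gt0.
move=> N s m N0 sN Mm y0 sy0; rewrite -/e.
have m0 : 0 <= m by have [x /Mm] := M_nonempty; exact: le_trans.
have KN0 : 0 <= Kremez * N%:R `^ e.
  by rewrite !mulr_ge0 ?powR_ge0// invr_ge0 ltW.
have [->|P0] := eqVneq (monomial_sum s y0) 0.
  by rewrite normr0 mulr_ge0// exprn_ge0.
have y01 : nsq y0 = 1 by rewrite -sqr_enorm sy0 expr1n.
have [k _ ymax] := @arg_maxP _ _ _ (ord0 : 'I_d.+1) xpredT (fun l => `|y0 0 l|) isT.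
have {}ymax l : `|y0 0 l| <= `|y0 0 k| by exact: ymax.
pose D := (2 * N)%N; have D0 : (0 < D)%N by rewrite muln_gt0.
have D1 : 1 <= D%:R :> R by rewrite ler1n.
have X1 : 1 <= (C3 * D%:R ^+ 2) `^ beta^-1.
  rewrite -[leLHS](powRr0 (C3 * D%:R ^+ 2)); apply: ler_powR.
    by rewrite -[leLHS]mulr1 ler_pM// exprn_ege1.
  by rewrite invr_ge0 ltW.
have [j0 /andP[Xj jX]] := dyadic_approx X1.
have [b [l [b0 l0 _ lip]]] := pullback_lip y0 k L N s.
have := @lead_coef_le R d D (pullback y0 k L N s) `|monomial_sum s y0| D0 (normr_ge0 _)
  (fun y i => pullback_line y01 ymax L_ge1 sN y i P0)
  a j0 d_gt0 (fun j => ltn0Sn _) sum_a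
  (fun y => [/\ forall i, 0 <= y i < 1, M (stereo y0 k L y) &
                nsq (hyper y0 k L y) <= (2 / rho) ^+ 2])
  ((2 / rho) ^+ D * m) l.
have bnd (y : 'I_d -> R) : [/\ forall i, 0 <= y i < 1, M (stereo y0 k L y) &
                nsq (hyper y0 k L y) <= (2 / rho) ^+ 2] ->
    `|pullback y0 k L N s y| <= (2 / rho) ^+ D * m /\ forall i, 0 <= y i < 1.
  move=> [yi yM yn]; split=> //; rewrite pullbackE// normrM.
  apply: ler_pM => //; last exact: Mm.
  rewrite ger0_norm ?exprn_ge0 ?nsq_ge0// /D exprM.
  by rewrite lerXn2r ?nnegrE ?nsq_ge0 ?exprn_ge0// divr_ge0// ltW.
move=> /(_ bnd lip (fun K B => cells_miss y01 ymax D0 Xj)).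
set c := `|_|; have q0 : 0 < (16 * D * 2 ^ j0)%:R :> R.
  by rewrite ltr0n muln_gt0 muln_gt0 D0 expn_gt0.
rewrite exprVn ler_pdivrMr ?exprn_gt0// => hc.
have r0 : 0 < 2 / rho by rewrite divr_gt0.
have le1 : 2 * (2 / rho) * (16 * D * 2 ^ j0)%:R <= Kremez * N%:R `^ e.
  rewrite natrM natrM natrX.
  have NE : N%:R `^ e = D%:R * (D%:R ^+ 2) `^ beta^-1 / 2 `^ e.
    have D0' : 0 < D%:R :> R by rewrite ltr0n.
    have -> : D%:R * (D%:R ^+ 2) `^ beta^-1 = D%:R `^ e.
      have Dn : D%:R != 0 :> R by rewrite gt_eqF.
      rewrite eE powRD ?Dn ?implybT//.
      by rewrite powRr1 ?ltW// powRrM powR_mulrn// ltW.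
    by rewrite /D natrM powRM// [X in X / _]mulrC mulfK// gt_eqF// powR_gt0.
  have X2 : (C3 * D%:R ^+ 2) `^ beta^-1 = C3 `^ beta^-1 * (D%:R ^+ 2) `^ beta^-1.
    by rewrite powRM ?exprn_ge0// ltW.
  have -> : Kremez * N%:R `^ e = 2 * (2 / rho) * (16 * D%:R * (2 * (C3 * D%:R ^+ 2) `^ beta^-1)).
    rewrite NE X2 /Kremez; have : 2 `^ e != 0 :> R by rewrite gt_eqF// powR_gt0.
    move: (2 `^ e) => z z0; field.
    by rewrite z0 gt_eqF.
  rewrite ler_pM2l; last by rewrite mulr_gt0.
  by rewrite ler_pM2l// mulr_gt0// ltr0n.
apply: le_trans hc _.
have -> : 2 * ((2 / rho) ^+ D * m) * (16 * D * 2 ^ j0)%:R ^+ D =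
  (2 * ((2 / rho) * (16 * D * 2 ^ j0)%:R) ^+ D) * m.
  by rewrite [in RHS]exprMn; move: (_ ^+ D) (_ ^+ D) => u v; ring.
rewrite ler_wpM2r//; apply: (@le_trans _ _ ((2 * (2 / rho) * (16 * D * 2 ^ j0)%:R) ^+ D)).
  rewrite [leRHS](_ : _ = 2 ^+ D * (2 / rho * (16 * D * 2 ^ j0)%:R) ^+ D); last first.
    by rewrite -exprMn; congr (_ ^+ _); ring.
  rewrite ler_wpM2r//; last by rewrite -natrX ler_nat -{1}(expn1 2) leq_exp2l.
  by rewrite exprn_ge0// mulr_ge0 ?ltW.
by apply: lerXn2r; rewrite ?nnegrE// mulr_ge0// mulr_ge0// ltW.
Qed.

End Pointwise.

(** Needed so that the [sup] of |p| is a true supremum; coordinates of unit vectors are at most 1 in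
    modulus. *)
Lemma monomial_sum_bounded (R : realType) n (s : seq (R * {ffun 'I_n -> nat})) x :
  sphere n x -> `|monomial_sum s x| <= \sum_(c <- s) `|c.1|.
Proof.
move=> sx; apply: le_trans (ler_norm_sum _ _ _) _; apply: ler_sum => c _.
rewrite normrM ler_piMr// normr_prod.
apply: (@le_trans _ _ (\prod_(i < n) 1)); last by rewrite big1.
apply: ler_prod => i _; rewrite normr_ge0 normrX exprn_ile1//.
rewrite -[leRHS](_ : enorm x = 1)// -[leLHS]sqrtr_sqr.
by rewrite ler_wsqrtr// (bigD1 i)//= lerDl sumr_ge0// => k _; exact: sqr_ge0.
Qed.

(* hausdorff_content takes values in \bar R; it is finite on the bounded set M,
   so that fine is its actual value. *)
Theorem theorem1p1 (R : realType) :
  exists C1 : R, 0 < C1 /\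
  forall (n : nat) (delta : R) (M : set 'rV[R]_n),
    (2 <= n)%N -> 0 < delta < 1 ->
    M `<=` sphere n -> closed M ->
    (0 < hausdorff_content (n%:R - 2 + delta) M)%E ->
  exists C2 : R, 0 < C2 /\
  forall (N : nat) (p : 'rV[R]_n -> R),
    (0 < N)%N -> spherical_polynomial N p ->
    sup_abs (sphere n) p <=
      C1 * ((C2 / fine (hausdorff_content (n%:R - 2 + delta) M)) `^ (2 / delta)
            * N%:R `^ (4 / delta - 1)) ^+ (2 * N) * sup_abs M p.
Proof.
exists 1; split=> // -[//|d] delta M; rewrite ltnS => d0 /andP[delta0 delta1] MS _.
have -> : d.+1%:R - 2 + delta = d%:R - 1 + delta by rewrite -natr1; ring.
set H := hausdorff_content _ M => H0.
have a0 : 0 < d%:R - 1 + delta.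
  by have : 1 <= d%:R :> R; [rewrite ler1n | lra].
(* A single ball of radius 2 covers [M]. *)
have Hfin : H \is a fin_num.
  rewrite ge0_fin_numE; last exact: ltW.
  have := @hausdorff_content_le _ _ _ M [:: (0, 2)] a0.
  rewrite big_seq1 /= => h; apply: le_lt_trans (h _ _) (ltry _).
    by move=> p; rewrite inE => /eqP ->.
  move=> x /MS sx; exists (0, 2); rewrite ?mem_head// /eball /= subr0 sx.
  by rewrite ltr1n.
pose h := fine H; have hE : H = h%:E by rewrite fineK.
have h0 : 0 < h by rewrite -lte_fin -hE.
have hH : (h%:E <= H)%E by rewrite hE.
have [K [K0 remez]] := remez_pointwise d0 delta0 delta1 MS h0 hH.
(* Chosen so that (C2 / H)^(2/delta) is exactly [K]. *)
exists (h * K `^ (delta / 2)); split; first by rewrite mulr_gt0// powR_gt0.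
have -> : (h * K `^ (delta / 2) / fine H) `^ (2 / delta) = K.
  rewrite -/h [h * _]mulrC mulfK ?gt_eqF// -powRrM.
  rewrite (_ : delta / 2 * (2 / delta) = 1); last by field; rewrite gt_eqF.
  by rewrite powRr1// ltW.
move=> N p N0 /spherical_polynomial_sum[s [sN ps]]; rewrite mul1r.
have bnd A : A `<=` sphere d.+1 -> has_ubound [set `|p x| | x in A].
  move=> AS; exists (\sum_(c <- s) `|c.1|) => _ [x Ax <-].
  by rewrite ps; [exact: monomial_sum_bounded (AS _ Ax) | exact: AS].
have Mm x : M x -> `|monomial_sum s x| <= sup_abs M p.
  by move=> Mx; rewrite -ps; [apply: ub_le_sup; [exact: bnd | exists x] | exact: MS].
have Sne : [set `|p x| | x in sphere d.+1] !=set0.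
  exists `|p (delta_mx 0 0)|, (delta_mx 0 0) => //=.
  rewrite /sphere /= /enorm (bigD1 0)//= big1 ?mxE ?eqxx ?addr0 ?expr1n ?sqrtr1// => i i0.
  by rewrite mxE (negPf i0) andbF expr0n.
apply: ge_sup => // _ [y0 sy0 <-]; rewrite ps//.
exact: remez N0 sN Mm y0 sy0.
Qed.
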